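(* Consider the $M$-lock, $n$-agent acquisition game described in the context. For every agent $i$ and every strategy profile $\pi^{-i}=(\pi^m)_{m\neq i}$ of the opponents, there exists a threshold strategy (T-strategy) $\pi^{i*}$ of agent $i$ that is a best response to $\pi^{-i}$, i.e. $\phi^i(\pi^{i*},\pi^{-i})=\sup_{\pi^i\in S^i}\phi^i(\pi^i,\pi^{-i})$, where the supremum is over all strategies of agent $i$.
   Context: Data: number of agents $n$, number of locks $M\ge 1$, deadline $T>0$, trade-off factor $\nu>0$, maximal rates $\beta^i>0$, and rewards $c^i_k$ ($1\le i\le n$, $1\le k\le M$). Rate functions: for $0\le \tau\le T$, $L^\infty[\tau,T]$ (for agent $i$) denotes the set of measurable functions $a:[\tau,T]\to[0,\beta^i]$, and $\bar a(t)=\int_\tau^t a(s)\,ds$. States: the state of agent $i$ at its $k$-th decision epoch is $z=(l,\tau)$, where $l\in\{0,1\}$ ($1$ means all contacts so far were successful) and $\tau=\tau^i_{k-1}$ is the time of its $(k-1)$-th contact. The initial state is $z^i_1=(1,0)$. Strategies: a strategy $\pi^i\in S^i$ is a collection of rate functions $a^i_k(\cdot\,;z)\in L^\infty[\tau,T]$, one for each $k\in\{1,\dots,M\}$ and each state $z=(l,\tau)$ (depending measurably on $z$, so that the expectations below are defined). Failure probability of opponents: $\eta^i_1(t;\pi^{-i})=\exp\big(-\sum_{m\ne i}\bar a^m_1(t)\big)$, where $a^m_1=a^m_1(\cdot\,;(1,0))$, and $\eta^i_k\equiv 1$ for $k>1$. Dynamics: in state $z^i_k=(1,\tau^i_{k-1})$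 with $\tau^i_{k-1}<T$, using $a=a^i_k(\cdot\,;z^i_k)$, the next contact time $\tau^i_k$ satisfies $P(\tau^i_k>t)=e^{-\bar a(t)}$ for $t\in[\tau^i_{k-1},T]$ (no contact before $T$ means $\tau_k^i>T$, and no further rewards or costs). Given contact at time $s\le T$, the contact is successful ($z^i_{k+1}=(1,s)$) with probability $\eta^i_k(s;\pi^{-i})$, and otherwise $z^i_{k+1}=(0,s)$. Stage utility: $r^i_k(z^i_k,a;\pi^{-i})=c^i_k\int_{\tau^i_{k-1}}^T\eta^i_k(s;\pi^{-i})e^{-\bar a(s)}a(s)\,ds-\nu\Big(\bar a(T)e^{-\bar a(T)}+\int_{\tau^i_{k-1}}^T\bar a(s)e^{-\bar a(s)}a(s)\,ds\Big)$ if $z_k^i=(1,\tau^i_{k-1})$ with $\tau^i_{k-1}<T$, and $r^i_k=0$ otherwise. Total utility: $\phi^i(\pi^i,\pi^{-i})=\sum_{k=1}^M E[r^i_k(z^i_k,a^i_k;\pi^{-i})\mid z^i_1=(1,0)]$. Threshold policy: $\Gamma_{\theta;s}:[s,T]\to[0,\beta^i]$, with $0\le\theta\le T$, is given by $\Gamma_{\theta;s}(t)=\beta^i$ if $t\le\theta$ and $0$ otherwise (identically zero if $s>\theta$). T-strategy: a strategy for which there are functions $\theta_1(\cdot),\dots,\theta_M(\cdot)$ with values in $[0,T]$ such that, for every $k$, $a_k(\cdot\,;(1,s))=\Gamma_{\theta_k(s);s}$ and $a_k(\cdot\,;(0,s))=\Gamma_{0;s}$ for all $s$. *)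

(* Defs.v *)
From HB Require Import structures.
From mathcomp Require Import all_boot all_order all_algebra.
From mathcomp Require Import all_classical all_reals all_analysis.
From mathcomp Require Import measurable_realfun lra ring.

Set Implicit Arguments.
Unset Strict Implicit.
Unset Printing Implicit Defensive.
Import Order.TTheory GRing.Theory Num.Theory.
Import numFieldNormedType.Exports.

Local Open Scope classical_set_scope.
Local Open Scope ring_scope.

(* Locks, and the decision epochs of an agent, are numbered 1, ..., M by natural
   numbers; no definition looks at an index outside this range. *)

(* (l, tau).  Any tau > T means that there was no contact before the deadline. *)
Notation state R := (bool * Real.sort R)%type.

(* p k z t is the rate a_k(t; z). *)
Definition policy (R : realType) : Type := nat -> state R -> R -> R.

Definition rate_function (R : realType) (T b tau : R) (a : R -> R) : Prop :=
  measurable_fun `[tau, T] a /\ forall t, tau <= t <= T -> 0 <= a t <= b.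

(* A policy is a total function; only its values at 0 <= tau <= t <= T matter, and
   measurable dependence on the state is joint measurability there. *)
Definition strategy (R : realType) (M : nat) (T b : R) : set (policy R) :=
  [set p | forall k, (1 <= k <= M)%N ->
    (forall z : state R, 0 <= z.2 <= T -> rate_function T b z.2 (p k z)) /\
    measurable_fun
      [set x : state R * R | [/\ 0 <= x.1.2, x.1.2 <= x.2 & x.2 <= T]]
      (fun x => p k x.1 x.2)].

(* abar a tau t is the cumulative rate, the integral of a over [tau, t]. *)
Definition abar (R : realType) (a : R -> R) (tau t : R) : R :=
  \int[lebesgue_measure]_(s in `[tau, t]) a s.

(* Only the components m != i of the profile sigma are used. *)
Definition failure_prob (R : realType) (n : nat) (i : 'I_n)
    (sigma : 'I_n -> policy R) (k : nat) (t : R) : R :=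
  if k == 1%N then expR (- \sum_(m < n | m != i) abar (sigma m 1%N (true, 0)) 0 t)
  else 1.

Definition active (R : realType) (T : R) (z : state R) : bool :=
  z.1 && (0 <= z.2 < T).

(* The law of the next state, when the current state is z, the rate function is
   a and a contact at time s succeeds with probability eta s.  The next contact
   time has density a(s) exp(- abar(s)) on [tau, T]; the remaining mass
   exp(- abar(T)) is that of "no contact before T", encoded by the time T + 1.
   By next_contact_survival below, this is the law such that the contact time
   exceeds t with probability exp(- abar(t)).  The states that are not active
   yield no reward and are made absorbing. *)
Definition next_state (R : realType) (T : R) (eta a : R -> R) (z : state R)
    (A : set (state R)) : \bar R :=
  if active T z then
    (\int[lebesgue_measure]_(s in `[z.2, T])
       (a s * expR (- abar a z.2 s) *
        (eta s * \1_A (true, s) + (1 - eta s) * \1_A (false, s)))%:E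
     + (expR (- abar a z.2 T))%:E * \d_((true, (T + 1)%R) : state R) A)%E
  else \d_z A.

Lemma expR_gap (R : realType) (u v K I : R) :
  0 <= u -> 0 <= v - u <= K ->
  (v - u) * expR (- v) <= I -> I <= (v - u) * expR (- u) ->
  `|I - (expR (- u) - expR (- v))| <= K ^+ 2.
Proof.
move=> u0; set D := v - u => /andP[D0 DK] lower upper.
have p1 : expR (- u) <= 1 by rewrite -expR0 ler_expR; lra.
have p0 := expR_gt0 (- u); have q0 := expR_gt0 (- v).
have pE : expR (- u) = expR (- v) * expR D.
  by rewrite -expRD; congr expR; rewrite /D; ring.
have qE : expR (- v) = expR (- u) * expR (- D).
  by rewrite -expRD; congr expR; rewrite /D; ring.
have e1 := expR_ge1Dx D; have e2 := expR_ge1Dx (- D).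
move: (expR (- u)) (expR (- v)) (expR D) (expR (- D)) p1 p0 q0 pE qE e1 e2 lower upper.
move: D D0 DK => D D0 DK p q E E' p1 p0 q0 pE qE e1 e2 lower upper.
have g1 : D * q <= p - q.
  have : 0 <= q * (E - (1 + D)) by rewrite mulr_ge0//; lra.
  by move=> ?; lra.
have g2 : p - q <= D * p.
  have : 0 <= p * (E' - (1 - D)) by rewrite mulr_ge0//; lra.
  by move=> ?; lra.
have DK2 : D * D <= K ^+ 2 by rewrite expr2 ler_pM.
have g3 : 0 <= D * (1 - p) by rewrite mulr_ge0//; lra.
have g4 : 0 <= D * (D - (p - q)) by rewrite mulr_ge0//; lra.
by rewrite ler_norml; apply/andP; split; lra.
Qed.

Section contact_law.
Context (R : realType) (T b tau : R) (a : R -> R)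
  (ha : rate_function T b tau a).
Let mu := @lebesgue_measure R.
Let dens s := a s * expR (- abar a tau s).

Let bounded_integrable (f : R -> R) (K : R) :
  measurable_fun `[tau, T] f -> (forall t, tau <= t <= T -> `|f t| <= K) ->
  mu.-integrable `[tau, T] (EFin \o f).
Proof.
move=> mf fK; apply: measurable_bounded_integrable => //.
  by rewrite /mu /= lebesgue_measure_itv/=; case: ifP => // _; rewrite -EFinD ltry.
exists K; split; first exact: num_real.
move=> x Kx t /=; rewrite in_itv/= => tT.
by rewrite (le_trans (fK _ tT))// ltW.
Qed.

Let rate_integrable : mu.-integrable `[tau, T] (EFin \o a).
Proof.
case: ha => ma a0b; apply: (bounded_integrable (K := b)) => // t tT.
by have /andP[a0 ab] := a0b _ tT; rewrite ger0_norm.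
Qed.

Let abar_diff x y : tau <= x -> x <= y -> y <= T ->
  abar a tau y - abar a tau x = \int[mu]_(s in `]x, y]) a s.
Proof.
move=> tx xy yT; rewrite /abar; apply: Rintegral_itvB => //.
apply: integrableS rate_integrable => //.
by apply: subset_itvl; rewrite bnd_simp.
Qed.

Let mu_itv x y : x <= y -> fine (mu `]x, y]) = y - x.
Proof.
move=> xy; rewrite /mu /= lebesgue_measure_itv/= lte_fin.
by case: ltgtP xy => //= -> _; rewrite subrr.
Qed.

Let subitv x y : tau <= x -> y <= T -> `]x, y] `<=` `[tau, T].
Proof. by move=> tx yT; apply: subset_itv; rewrite bnd_simp. Qed.

Let cst_integrable x y (r : R) : mu.-integrable `]x, y] (EFin \o cst r).
Proof.
apply: measurable_bounded_integrable => //.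
  by rewrite /mu /= lebesgue_measure_itv/=; case: ifP => // _; rewrite -EFinD ltry.
by exists `|r|; split; [exact: num_real|move=> z rz t _ /=; exact: ltW].
Qed.

Let abar_bounds x y : tau <= x -> x <= y -> y <= T ->
  0 <= abar a tau y - abar a tau x <= b * (y - x).
Proof.
move=> tx xy yT; rewrite abar_diff//.
have a0b t : `]x, y]%classic t -> 0 <= a t <= b.
  move=> /= /(subitv tx yT) /=; rewrite in_itv/=; exact: ha.2.
apply/andP; split.
  by apply: Rintegral_ge0 => t /a0b/andP[].
rewrite -mu_itv// -Rintegral_cst//; apply: le_Rintegral => //.
- by apply: integrableS rate_integrable => //; exact: subitv.
- exact: cst_integrable.
- by move=> t /a0b/andP[].
Qed.

Let dens_integrable : mu.-integrable `[tau, T] (EFin \o dens).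
Proof.
case: (leP tau T) => tT; last by rewrite set_itv_ge ?bnd_simp -?ltNge// integrable_set0.
case: (ha) => ma a0b; apply: (bounded_integrable (K := b)).
  apply: measurable_funM => //; apply: measurableT_comp => //.
  apply: measurableT_comp => //.
  apply: subspace_continuous_measurable_fun => //.
  exact: parameterized_integral_continuous.
move=> t /andP[t1 t2]; have /andP[a0 ab] := a0b t (introT andP (conj t1 t2)).
rewrite ger0_norm ?mulr_ge0 ?expR_ge0// -[leRHS]mulr1.
rewrite ler_pM ?expR_ge0//.
rewrite -[leRHS]expR0 ler_expR oppr_le0.
by apply: Rintegral_ge0 => s /=; rewrite in_itv/= => /andP[s1 s2];
  have /andP[] := a0b s (introT andP (conj s1 (le_trans s2 t2))).
Qed.

Let gap x y := \int[mu]_(s in `]x, y]) dens s -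
  (expR (- abar a tau x) - expR (- abar a tau y)).

Let gap_le x y : tau <= x -> x <= y -> y <= T ->
  `|gap x y| <= (b * (y - x)) ^+ 2.
Proof.
move=> tx xy yT; have /andP[D0 Db] := abar_bounds tx xy yT.
have ia : mu.-integrable `]x, y] (EFin \o a).
  by apply: integrableS rate_integrable => //; exact: subitv.
have id : mu.-integrable `]x, y] (EFin \o dens).
  by apply: integrableS dens_integrable => //; exact: subitv.
have hD r : \int[mu]_(s in `]x, y]) (a s * r) =
    (abar a tau y - abar a tau x) * r.
  by rewrite RintegralZr// -abar_diff.
have ir r : mu.-integrable `]x, y] (EFin \o (fun s => a s * r)).
  rewrite [X in _.-integrable _ X](_ : _ = fun s => ((a s)%:E * r%:E)%E).
    exact: integrableZr.
  by apply/funext => s; rewrite /= EFinM.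
have upper : \int[mu]_(s in `]x, y]) dens s <= (abar a tau y - abar a tau x) * expR (- abar a tau x).
  rewrite -hD; apply: le_Rintegral;
    [exact: measurable_itv|exact: id|exact: ir|move=> s /=; rewrite /dens].
  rewrite in_itv/= => /andP[xs sy].
  have sT := le_trans sy yT; have ts := le_trans tx (ltW xs).
  have /andP[a0 _] := ha.2 s (introT andP (conj ts sT)).
  apply: ler_wpM2l; first exact: a0.
  rewrite ler_expR lerN2 -subr_ge0.
  by have /andP[] := abar_bounds tx (ltW xs) sT.
have lower : (abar a tau y - abar a tau x) * expR (- abar a tau y) <= \int[mu]_(s in `]x, y]) dens s.
  rewrite -hD; apply: le_Rintegral;
    [exact: measurable_itv|exact: ir|exact: id|move=> s /=; rewrite /dens].
  rewrite in_itv/= => /andP[xs sy].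
  have sT := le_trans sy yT; have ts := le_trans tx (ltW xs).
  have /andP[a0 _] := ha.2 s (introT andP (conj ts sT)).
  apply: ler_wpM2l; first exact: a0.
  rewrite ler_expR lerN2 -subr_ge0.
  by have /andP[] := abar_bounds ts sy yT.
apply: (expR_gap _ _ lower upper).
  apply: Rintegral_ge0 => s /=; rewrite in_itv/= => /andP[s1 s2].
  by have /andP[] := ha.2 s (introT andP (conj s1 (le_trans s2 (le_trans xy yT)))).
by rewrite D0 Db.
Qed.

Let gap_add x y z : tau <= x -> x <= y -> y <= z -> z <= T ->
  gap x z = gap x y + gap y z.
Proof.
move=> tx xy yz zT.
have : \int[mu]_(s in `]x, z]) dens s - \int[mu]_(s in `]x, y]) dens s =
   \int[mu]_(s in `]y, z]) dens s.
  apply: Rintegral_itvB; rewrite ?bnd_simp//.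
  by apply: integrableS dens_integrable => //; exact: subitv.
by rewrite /gap; lra.
Qed.

Lemma contact_density x y : tau <= x -> x <= y -> y <= T ->
  (\int[lebesgue_measure]_(s in `]x, y]) (a s * expR (- abar a tau s))%:E)%E =
  (expR (- abar a tau x) - expR (- abar a tau y))%:E.
Proof.
move=> tx xy yT.
suff g0 : gap x y = 0.
  rewrite -[LHS]fineK; last first.
    apply: integrable_fin_num => //.
    by apply: integrableS dens_integrable => //; exact: subitv.
  by congr EFin; apply/eqP; rewrite -subr_eq0; apply/eqP.
have gapN d k : 0 <= d -> x + d *+ k <= T ->
    `|gap x (x + d *+ k)| <= (b * d) ^+ 2 *+ k.
  move=> d0; elim: k => [|k IH] kT.
    by have := gap_le tx (lexx x) (le_trans xy yT);
      rewrite !mulr0n addr0 subrr mulr0 expr0n.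
  have le1 : x + d *+ k <= x + d *+ k.+1 by rewrite lerD2l mulrS lerDr.
  have le0 : x <= x + d *+ k by rewrite lerDl mulrn_wge0.
  rewrite (gap_add tx le0 le1 kT) (le_trans (ler_normD _ _))//.
  rewrite [leRHS]mulrSr; apply: lerD; first exact/IH/(le_trans le1).
  rewrite (le_trans (gap_le (le_trans tx le0) le1 kT))// le_eqVlt.
  by apply/orP; left; apply/eqP; rewrite mulrS; ring.
have gapn n : `|gap x y| * n.+1%:R <= (b * (y - x)) ^+ 2.
  have n0 : (n.+1%:R : R) != 0 by rewrite pnatr_eq0.
  have yE : x + ((y - x) / n.+1%:R) *+ n.+1 = y.
    by rewrite -[_ *+ _]mulr_natr divfK// addrC subrK.
  have d0 : 0 <= (y - x) / n.+1%:R by rewrite divr_ge0// subr_ge0.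
  have := gapN _ n.+1 d0; rewrite yE => /(_ yT) gle.
  apply: le_trans (_ : (b * ((y - x) / n.+1%:R)) ^+ 2 *+ n.+1 * n.+1%:R <= _).
    by rewrite ler_wpM2r.
  by rewrite -[_ *+ _]mulr_natr le_eqVlt; apply/orP; left; apply/eqP; field.
apply/eqP; rewrite -normr_eq0 -[_ == _]negbK neq_lt normr_lt0 /= normr_gt0.
apply/negP; rewrite -normr_gt0 => g0.
have := archi_boundP (divr_ge0 (sqr_ge0 (b * (y - x))) (ltW g0)).
rewrite ltr_pdivrMr// ltNge => /negP; apply.
apply: le_trans (gapn (Num.bound ((b * (y - x)) ^+ 2 / `|gap x y|))).
by rewrite mulrC ler_wpM2l// ler_nat.
Qed.

End contact_law.

Lemma next_contact_survival (R : realType) (T b : R) (eta a : R -> R)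
    (z : state R) (t : R) :
  rate_function T b z.2 a -> active T z -> z.2 <= t <= T ->
  next_state T eta a z [set z' | t < z'.2] = (expR (- abar a z.2 t))%:E.
Proof.
move=> ha az /andP[zt tT]; rewrite /next_state az.
have -> : (\int[lebesgue_measure]_(s in `[z.2, T])
   (a s * expR (- abar a z.2 s) *
    (eta s * \1_[set z' : state R | (t < z'.2)%R] (true, s)
     + (1 - eta s) * \1_[set z' : state R | (t < z'.2)%R] (false, s)))%:E =
  \int[lebesgue_measure]_(s in `]t, T]) (a s * expR (- abar a z.2 s))%:E)%E.
  rewrite [LHS]integral_mkcond [RHS]integral_mkcond.
  apply: eq_integral => s _; rewrite !patchE !indicE.
  have mE l : ((l, s) \in [set z' : state R | t < z'.2]) = (t < s).
    by apply/idP/idP; rewrite inE.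
  rewrite !mE !mem_setE !in_itv/=.
  case: (ltP t s) => [ts|st].
    rewrite (le_trans zt (ltW ts))/=; case: ifP => // _.
    by congr EFin; ring.
  by case: ifP => // _; rewrite !mulr0 addr0 mulr0.
rewrite (contact_density ha)// diracE mem_set/=; last first.
  by rewrite (le_lt_trans tT)// ltrDl.
by rewrite mule1 -EFinD subrK.
Qed.

(* state_law T eta p j is the law of the state at epoch j + 1. *)
Fixpoint state_law (R : realType) (T : R) (eta : nat -> R -> R) (p : policy R)
    (j : nat) : set (state R) -> \bar R :=
  if j is j'.+1 then
    fun A => (\int[state_law T eta p j']_z next_state T (eta j) (p j z) z A)%E
  else \d_((true, 0) : state R).

Definition stage_utility (R : realType) (T nu c : R) (eta a : R -> R)
    (z : state R) : R :=
  if active T z then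
    c * \int[lebesgue_measure]_(s in `[z.2, T])
          (eta s * expR (- abar a z.2 s) * a s)
    - nu * (abar a z.2 T * expR (- abar a z.2 T)
            + \int[lebesgue_measure]_(s in `[z.2, T])
                (abar a z.2 s * expR (- abar a z.2 s) * a s))
  else 0.

(* Agent i plays p against the components m != i of sigma; c k is the reward
   of agent i for lock k. *)
Definition utility (R : realType) (n M : nat) (T nu : R) (c : nat -> R)
    (i : 'I_n) (p : policy R) (sigma : 'I_n -> policy R) : \bar R :=
  let eta := failure_prob i sigma in
  (\sum_(1 <= k < M.+1)
     \int[state_law T eta p k.-1]_z
       (stage_utility T nu (c k) (eta k) (p k z) z)%:E)%E.

Definition threshold_policy (R : realType) (b theta : R) (t : R) : R :=
  if t <= theta then b else 0.

Definition T_strategy (R : realType) (M : nat) (T b : R) : set (policy R) :=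
  [set p | strategy M T b p /\
    exists theta : nat -> R -> R,
      forall k s, (1 <= k <= M)%N -> 0 <= s <= T ->
        0 <= theta k s <= T /\
        forall t, s <= t <= T ->
          p k (true, s) t = threshold_policy b (theta k s) t /\
          p k (false, s) t = threshold_policy b 0 t].

(* Main.v *)
Require Import Defs.
From HB Require Import structures.
From mathcomp Require Import all_boot all_order all_algebra.
From mathcomp Require Import all_classical all_reals all_analysis.
From mathcomp Require Import finmap measurable_realfun ring.

(* Integrating by parts, the cost nu (abar(T) e^{-abar(T)} + int abar e^{-abar} a)
   of a stage equals int nu e^{-abar} a, so that a stage followed by a continuation
   value V earns the integral of the contact density a e^{-abar} against
   g(s) = eta(s) (c + V(s)) - nu.  If V >= 0 is nonincreasing, then so is
   g^+ = max(g, 0), because eta is nonincreasing.  Every admissible rate makes the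
   contact stochastically later than the maximal rate beta, hence earns at most
   int beta e^{-beta (s - tau)} g^+(s) ds, and switching from beta to 0 when g
   changes sign attains this bound.  The bound is again nonnegative and nonincreasing
   in tau: idling first is admissible.  Backward induction on the epochs, with the
   law of the next state integrated against the value functions, then yields an
   optimal strategy; its thresholds do not even depend on the last contact time. *)

Set Implicit Arguments.
Unset Strict Implicit.
Unset Printing Implicit Defensive.
Import Order.TTheory GRing.Theory Num.Theory.
Import numFieldNormedType.Exports.

Local Open Scope classical_set_scope.
Local Open Scope ring_scope.

(** * Measures from positive, monotonically continuous functionals *)

Section daniell.
Local Open Scope ereal_scope.
Context d (X : measurableType d) (R : realType).
Variable Phi : (X -> \bar R) -> \bar R.
Hypothesis Phi_ge0 : forall f, (forall x, 0 <= f x) -> 0 <= Phi f.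
Hypothesis PhiD : forall f g, measurable_fun setT f -> measurable_fun setT g ->
  (forall x, 0 <= f x) -> (forall x, 0 <= g x) ->
  Phi (fun x => f x + g x) = Phi f + Phi g.
Hypothesis PhiZ : forall r f, (0 <= r)%R -> measurable_fun setT f ->
  (forall x, 0 <= f x) -> Phi (fun x => r%:E * f x) = r%:E * Phi f.
Hypothesis Phi_cvg : forall f : (X -> \bar R)^nat,
  (forall n, measurable_fun setT (f n)) -> (forall n x, 0 <= f n x) ->
  (forall x, nondecreasing_seq (f ^~ x)) ->
  Phi (f n) @[n --> \oo] --> Phi (fun x => limn (f ^~ x)).

Let ind (A : set X) (x : X) : \bar R := (\1_A x)%:E.

Let mind A : measurable A -> measurable_fun setT (ind A).
Proof. by move=> mA; apply/measurable_EFinP. Qed.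

Let ind_ge0 A x : 0 <= ind A x.
Proof. by rewrite /ind lee_fin. Qed.

Let Phi0 : Phi (cst 0) = 0.
Proof.
rewrite (_ : cst 0 = fun x => 0%:E * ind set0 x); last first.
  by apply/funext => x; rewrite mul0e.
by rewrite PhiZ// ?mul0e//; exact: mind.
Qed.

Let Phi_sum I (s : seq I) (f : I -> X -> \bar R) :
  (forall i, measurable_fun setT (f i)) -> (forall i x, 0 <= f i x) ->
  Phi (fun x => \sum_(i <- s) f i x) = \sum_(i <- s) Phi (f i).
Proof.
move=> mf f0; elim: s => [|i s IH].
  by rewrite big_nil -[RHS]Phi0; congr Phi; apply/funext => x; rewrite big_nil.
rewrite big_cons -IH -PhiD//; last 2 first.
- exact: emeasurable_sum.
- by move=> x; exact: sume_ge0.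
by congr Phi; apply/funext => x; rewrite big_cons.
Qed.

Variable mu : set X -> \bar R.
Hypothesis muE : forall A, mu A = Phi (fun x => (\1_A x)%:E).

Let mu_semi_sigma_additive : semi_sigma_additive mu.
Proof.
move=> F mF tF mUF.
have -> : (fun n => \sum_(0 <= i < n) mu (F i)) =
    fun n => Phi (fun x => \sum_(0 <= i < n) ind (F i) x).
  apply/funext => n; rewrite Phi_sum//; last by move=> i; exact: mind.
  by apply: eq_bigr => i _; rewrite muE.
have -> : mu (\bigcup_n F n) =
    Phi (fun x => limn (fun n => \sum_(0 <= i < n) ind (F i) x)).
  rewrite muE; congr Phi; apply/funext => x.
  apply/esym/cvg_lim => //.
  (* Pointwise, the series of indicators of disjoint sets sums to the indicator of their union: this
     is countable additivity of the Dirac measure at [x]. *)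
  exact: (@measure_semi_sigma_additive _ _ _ (\d_x) F mF tF mUF).
apply: Phi_cvg.
- by move=> n; apply: emeasurable_sum => i; exact: mind.
- by move=> n x; exact: sume_ge0.
- by move=> x; apply: ereal_nondecreasing_series => *; exact: ind_ge0.
Qed.

Import HBNNSimple.

(** Countable additivity of [mu] is [Phi_cvg] applied to partial sums of indicators. The integral
    formula goes from indicators to simple functions by linearity, and on to measurable functions by
    increasing approximation. It serves to turn set functions given by iterated integrals, such as
    the state laws, into genuine measures. *)
Lemma daniell_integral : exists2 m : {measure set X -> \bar R},
  (m : set X -> \bar R) = mu &
  forall f, measurable_fun setT f -> (forall x, 0 <= f x) ->
    \int[m]_x f x = Phi f.
Proof.
have mu0 : mu set0 = 0.
  by rewrite muE -[RHS]Phi0; congr Phi; apply/funext => x; rewrite indic0.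
have mu_ge0 A : 0 <= mu A by rewrite muE; exact/Phi_ge0/ind_ge0.
pose M := isMeasure.Build d X R mu mu0 mu_ge0 mu_semi_sigma_additive.
pose m : {measure set X -> \bar R} := HB.pack mu M.
exists m => // f mf f0.
have mE A : m A = Phi (ind A) by exact: muE.
have Phi_nnsfun (h : {nnsfun X >-> R}) : \int[m]_x (h x)%:E = Phi (EFin \o h).
  have mp r : measurable (h @^-1` [set r]) by exact: measurable_funPTI.
  (* [Phi_sum] asks for nonnegative summands at every index, in the range of [h] or not. Writing the
     coefficient as a maximum with 0 ensures this and changes nothing on the range. *)
  have maxE r : r \in fset_set (range h) -> Num.max r 0%R = r.
    rewrite in_fset_set; last exact: fimfunP.
    by move=> /set_mem[x _ <-]; exact/max_idPl.
  have m0 (r : R) : (0 <= Num.max r 0)%R by rewrite le_max lexx orbT.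
  transitivity (Phi (fun x => \sum_(r <- fset_set (range h))
      (Num.max r 0%R)%:E * ind (h @^-1` [set r]) x)); last first.
    congr Phi; apply/funext => x /=.
    rewrite fimfunE fsbig_finite/=; last exact: fimfunP.
    rewrite -sumEFin; apply: eq_big_seq => r /maxE ->.
    by rewrite EFinM.
  rewrite Phi_sum; last 2 first.
  - by move=> r; apply: measurable_funeM; exact: mind.
  - by move=> r x; rewrite mule_ge0// lee_fin.
  rewrite integralT_nnsfun sintegralE fsbig_finite; last exact: fimfunP.
  apply: eq_big_seq => r /maxE rE; rewrite PhiZ//; last exact: mind.
  by rewrite rE mE.
pose f_ := nnsfun_approx measurableT mf.
have f_nd x : nondecreasing_seq (fun n => (f_ n x)%:E).
  by move=> a b ab; rewrite lee_fin; exact/lefP/nd_nnsfun_approx.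
have mf_ n : measurable_fun setT (EFin \o f_ n) by exact/measurable_EFinP.
have f_0 n x : 0 <= (f_ n x)%:E by rewrite lee_fin.
have fE : f = fun x => limn (fun n => (f_ n x)%:E).
  by apply/funext => x; apply/esym/cvg_lim => //; exact: cvg_nnsfun_approx.
rewrite fE; have /cvg_lim <-// := Phi_cvg mf_ f_0 f_nd.
rewrite monotone_convergence//.
by under eq_fun do rewrite Phi_nnsfun.
Qed.
End daniell.

(** * Cumulative rate and density of the contact time *)

Section rate.
Context (R : realType) (T b tau : R) (a : R -> R)
  (ha : rate_function T b tau a).
Let mu := @lebesgue_measure R.

Definition contact_dens (s : R) : R := a s * expR (- abar a tau s).

Lemma rate_ge0 t : tau <= t <= T -> 0 <= a t.
Proof. by move/ha.2/andP => []. Qed.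

Lemma rate_le t : tau <= t <= T -> a t <= b.
Proof. by move/ha.2/andP => []. Qed.

Lemma bounded_integrable_itv (x y : R) (f : R -> R) (K : R) :
  measurable_fun `[x, y] f -> (forall t, x <= t <= y -> `|f t| <= K) ->
  mu.-integrable `[x, y] (EFin \o f).
Proof.
move=> mf fK; apply: measurable_bounded_integrable => //.
  by rewrite /mu /= lebesgue_measure_itv/=; case: ifP => // _; rewrite -EFinD ltry.
exists K; split; first exact: num_real.
move=> r Kr t /=; rewrite in_itv/= => xty.
by rewrite (le_trans (fK _ xty))// ltW.
Qed.

Lemma rate_integrable : mu.-integrable `[tau, T] (EFin \o a).
Proof.
apply: (@bounded_integrable_itv _ _ _ b); first exact: ha.1.
by move=> t tT; rewrite ger0_norm ?rate_le ?rate_ge0.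
Qed.

Lemma abar_ge0 t : t <= T -> 0 <= abar a tau t.
Proof.
move=> tT; apply: Rintegral_ge0 => s /=; rewrite in_itv/= => /andP[ts st].
by rewrite rate_ge0// ts (le_trans st).
Qed.

Lemma abar_le_mul t : tau <= t <= T -> abar a tau t <= b * (t - tau).
Proof.
move=> /andP[taut tT].
have mE : fine (mu `[tau, t]) = t - tau.
  rewrite /mu /= lebesgue_measure_itv/= lte_fin.
  by case: ltgtP taut => //= -> _; rewrite subrr.
rewrite -mE -Rintegral_cst//; apply: le_Rintegral => //.
- apply: integrableS rate_integrable => //.
  by apply: subset_itvl; rewrite bnd_simp.
- by apply: (@bounded_integrable_itv _ _ _ `|b|).
- by move=> s /=; rewrite in_itv/= => /andP[ts st]; rewrite rate_le// ts (le_trans st).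
Qed.

Lemma measurable_abar : measurable_fun `[tau, T] (abar a tau).
Proof.
case: (leP tau T) => tT; last first.
  rewrite set_itv_ge ?bnd_simp -?ltNge//; exact: measurable_fun_set0.
apply: subspace_continuous_measurable_fun => //.
by apply: parameterized_integral_continuous => //; exact: rate_integrable.
Qed.

Lemma measurable_contact_dens : measurable_fun `[tau, T] contact_dens.
Proof.
apply: measurable_funM; first exact: ha.1.
apply: measurableT_comp => //; apply: measurableT_comp => //.
exact: measurable_abar.
Qed.

Lemma contact_dens_ge0 t : tau <= t <= T -> 0 <= contact_dens t.
Proof. by move=> tT; rewrite mulr_ge0 ?expR_ge0// rate_ge0. Qed.

Lemma contact_dens_le t : tau <= t <= T -> contact_dens t <= b.
Proof.
move=> tT; rewrite -[leRHS]mulr1 ler_pM ?expR_ge0 ?rate_ge0 ?rate_le//.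
by rewrite -[leRHS]expR0 ler_expR oppr_le0 abar_ge0//; case/andP: tT.
Qed.

Lemma abar_tau : abar a tau tau = 0.
Proof. by rewrite /abar set_itv1 Rintegral_set1. Qed.

Lemma integral_contact_dens x y : tau <= x -> x <= y -> y <= T ->
  (\int[mu]_(s in `[x, y]) (contact_dens s)%:E)%E =
  (expR (- abar a tau x) - expR (- abar a tau y))%:E.
Proof.
move=> tx xy yT; rewrite -(contact_density ha)//.
rewrite -integral_itv_obnd_cbnd//.
apply/measurable_EFinP.
apply: measurable_funS measurable_contact_dens => //.
by apply: subset_itv; rewrite bnd_simp.
Qed.

End rate.

Lemma abar_cst (R : realType) (b tau t : R) : tau <= t ->
  abar (cst b) tau t = b * (t - tau).
Proof.
move=> taut; rewrite /abar Rintegral_cst//; congr (_ * _).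
rewrite /= lebesgue_measure_itv/= lte_fin.
by move: taut; rewrite le_eqVlt => /orP[/eqP->|->//]; rewrite ltxx subrr.
Qed.

Lemma rate_function_cst (R : realType) (T b tau : R) : 0 <= b ->
  rate_function T b tau (cst b).
Proof. by move=> b0; split => // t _ /=; rewrite b0 lexx. Qed.

(** * Stochastic comparison with the maximal rate *)

Section comparison.
Context (R : realType) (T b tau : R) (a : R -> R)
  (ha : rate_function T b tau a).
Let mu := @lebesgue_measure R.
Local Open Scope ereal_scope.

(** [G s] is the length of the interval [[0, G s[], and Tonelli exchanges the two integrals.
    Measurability of [h] comes from the same theorem and is recorded because two such functions are
    later compared under the integral sign. *)
Lemma layer_cake (D : set R) (p G : R -> R) : measurable D ->
  measurable_fun D p -> measurable_fun D G ->
  (forall s, D s -> (0 <= p s)%R) -> (forall s, D s -> (0 <= G s)%R) ->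
  let h (y : R) := \int[mu]_(s in D `&` [set s : R | (0 <= y < G s)%R]) (p s)%:E in
  measurable_fun setT h /\
  \int[mu]_(s in D) (p s * G s)%:E = \int[mu]_y h y.
Proof.
move=> mD mp mG p0 G0 h.
(* Extension by zero outside [D] moves the problem to the whole plane, where Tonelli applies. *)
pose p' := p \_ D; pose G' := G \_ D.
have mp' : measurable_fun setT p' by exact: (measurable_restrictT p mD).1.
have mG' : measurable_fun setT G' by exact: (measurable_restrictT G mD).1.
have p'0 s : (0 <= p' s)%R.
  by rewrite /p' patchE; case: ifPn => // /set_mem/p0.
pose F (x : R * R) : \bar R := (p' x.1 * (0 <= x.2 < G' x.1)%R%:R)%:E.
have mF : measurable_fun setT F.
  apply/measurable_EFinP; apply: measurable_funM.
    exact: measurableT_comp.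
  apply: (@measurableT_comp _ _ _ _ _ _ (fun t : bool => t%:R : R)) => //.
  apply: measurable_and.
    exact: measurable_fun_ler.
  by apply: measurable_fun_ltr => //; exact: measurableT_comp.
have F0 x : 0 <= F x by rewrite lee_fin mulr_ge0.
have hE : h = fun y => \int[mu]_s F (s, y).
  apply/funext => y; rewrite /h integral_mkcond; apply: eq_integral => s _.
  rewrite /F /p' /G' /= !patchE in_setI.
  case: (boolP (s \in D)) => sD /=; last by rewrite mul0r.
  have -> : (s \in [set s : R | (0 <= y < G s)%R]) = (0 <= y < G s)%R.
    by apply/idP/idP => [/set_mem|/mem_set].
  by case: ifP; rewrite ?mulr1 ?mulr0.
split; first by rewrite hE; exact: measurable_fun_fubini_tonelli_G.
rewrite hE -[RHS](fubini_tonelli (m1 := @lebesgue_measure R)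
  (m2 := @lebesgue_measure R) F)// integral_mkcond.
apply: eq_integral => s _.
rewrite patchE; case: ifPn => [|] sD; last first.
  rewrite integral0_eq// => y _.
  by rewrite /F /p' patchE (negbTE sD) mul0r.
rewrite /F /p' /G' /= !patchE sD.
under eq_integral do rewrite EFinM.
rewrite ge0_integralZl//; last 2 first.
- apply/measurable_EFinP.
  apply: (@measurableT_comp _ _ _ _ _ _ (fun t : bool => t%:R : R)) => //.
  apply: measurable_and.
    exact: measurable_fun_ler.
  exact: measurable_fun_ltr.
- by rewrite lee_fin p0//; exact/set_mem.
rewrite EFinM; congr (_ * _).
transitivity (mu `[0%R, G s[).
  rewrite /mu /= lebesgue_measure_itv/= lte_fin oppr0 adde0.
  by have := G0 s (set_mem sD); rewrite le_eqVlt => /orP[/eqP<-|->//]; rewrite ltxx.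
transitivity (\int[mu]_y (\1_(`[0%R, G s[%classic) y)%:E).
  by rewrite integral_indic// setIT.
by apply: eq_integral => y _; rewrite indicE mem_setE in_itv.
Qed.

(* The contact time under [a] is stochastically later than under the maximal
   rate, and every superlevel set of [G] is an initial interval. *)
Lemma contact_dens_comparison (G : R -> R) : measurable_fun `[tau, T] G ->
  {in `[tau, T] &, {homo G : x y /~ (x <= y)%R}} ->
  (forall s, (tau <= s <= T)%R -> (0 <= G s)%R) -> (0 <= b)%R ->
  \int[mu]_(s in `[tau, T]) (contact_dens tau a s * G s)%:E <=
  \int[mu]_(s in `[tau, T]) (contact_dens tau (cst b) s * G s)%:E.
Proof.
move=> mG ndG G0 b0.
have hb := rate_function_cst T tau b0.
have mda := measurable_contact_dens ha; have mdb := measurable_contact_dens hb.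
have mS (y : R) : measurable (`[tau, T] `&` [set s : R | (0 <= y < G s)%R]).
  have [y0|y0] := leP 0%R y; last first.
    rewrite [X in _ `&` X](_ : _ = set0) ?setI0//.
    by rewrite -subset0 => s.
  rewrite [X in _ `&` X](_ : _ = G @^-1` `]y, +oo[); first exact: mG.
  by apply/seteqP; split => s /=; rewrite in_itv/= andbT.
have [s /=|s /=|ha1 haE] := layer_cake (measurable_itv _) mda mG.
- by rewrite in_itv/= => /(contact_dens_ge0 ha).
- by rewrite in_itv/= => /G0.
have [s /=|s /=|hb1 hbE] := layer_cake (measurable_itv _) mdb mG.
- by rewrite in_itv/= => /(contact_dens_ge0 hb).
- by rewrite in_itv/= => /G0.
rewrite [leLHS]haE [leRHS]hbE {haE hbE}.
apply: ge0_le_integral; [exact: measurableT| |exact: ha1|exact: hb1|].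
- by move=> y _; apply: integral_ge0 => s [/=]; rewrite in_itv/= => /(contact_dens_ge0 ha).
move=> y _; set S := `[tau, T] `&` _.
have [->|/set0P[s0 Ss0]] := eqVneq S set0; first by rewrite !integral_set0.
have ST s : S s -> (tau <= s <= T)%R by move=> [/=]; rewrite in_itv.
have Sdown s t : S s -> (tau <= t <= s)%R -> S t.
  move=> [/=]; rewrite in_itv/= => /andP[taus sT] /andP[y0 yGs] /andP[taut ts].
  have tT := le_trans ts sT.
  split => /=; first by rewrite in_itv/= taut.
  by rewrite y0 (lt_le_trans yGs)// ndG// in_itv/= ?taus ?taut.
have supS : has_sup S.
  by split; [exists s0|exists T => s /ST/andP[]].
(* With a point, [S] contains every earlier point down to [tau]; it therefore lies between [[tau,
   x[] and [[tau, x]], which differ by a null set. *)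
set x := sup S.
have xT : (x <= T)%R by apply: ge_sup; [exists s0|move=> s /ST/andP[]].
have taux : (tau <= x)%R.
  have /andP[taus _] := ST _ Ss0.
  by rewrite (le_trans taus)//; exact: (ub_le_sup supS.2 Ss0).
have Sx : S `<=` `[tau, x].
  move=> s Ss /=; rewrite in_itv/=; have /andP[-> _] := ST _ Ss.
  exact: (ub_le_sup supS.2 Ss).
have xS : `[tau, x[ `<=` S.
  move=> s /=; rewrite in_itv/= => /andP[taus sx].
  have [t St st] := sup_gt (ex_intro _ _ Ss0) sx.
  by apply: (Sdown t) => //; rewrite taus ltW.
have subT A : A `<=` S -> A `<=` `[tau, T].
  by move=> AS s /AS/ST; rewrite /= in_itv.
have mEa A : measurable A -> A `<=` `[tau, T] ->
    measurable_fun A (EFin \o contact_dens tau a).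
  by move=> mA AT; apply/measurable_EFinP; exact: measurable_funS mda.
have mEb A : measurable A -> A `<=` `[tau, T] ->
    measurable_fun A (EFin \o contact_dens tau (cst b)).
  by move=> mA AT; apply/measurable_EFinP; exact: measurable_funS mdb.
have xsub : `[tau, x] `<=` `[tau, T].
  by apply: subset_itvl; rewrite bnd_simp.
(* Enlarge [S] to [[tau, x]] under [a], change to the maximal rate there, then shrink back to [S].
   The masses of [[tau, x]] are of the form 1 - e^{-abar(x)}, and
   [abar a tau x <= b * (x - tau)]. *)
apply: (@le_trans _ _ (\int[mu]_(s in `[tau, x]) (contact_dens tau a s)%:E)).
  apply: ge0_subset_integral => //; [exact: mS|exact: mEa|].
  by move=> s /xsub/=; rewrite in_itv/= => /(contact_dens_ge0 ha).
apply: (@le_trans _ _ (\int[mu]_(s in `[tau, x]) (contact_dens tau (cst b) s)%:E)).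
  rewrite (integral_contact_dens ha)// (integral_contact_dens hb)//.
  rewrite !abar_tau lee_fin lerD2l lerN2 ler_expR lerN2 abar_cst//.
  by rewrite (abar_le_mul ha)// taux.
rewrite -integral_itv_bndo_bndc; last by apply: mEb => //; exact: subT.
apply: ge0_subset_integral => //; [exact: mS|by apply: mEb; [exact: mS|exact: subT]|].
by move=> s /ST sT; rewrite lee_fin; exact: (contact_dens_ge0 hb sT).
Qed.

End comparison.

(** * The stage utility as an integral against the contact density *)

Section stage.
Context (R : realType) (T b tau : R) (a : R -> R)
  (ha : rate_function T b tau a) (tauT : tau <= T).
Let mu := @lebesgue_measure R.
Let A := abar a tau.
Let p := contact_dens tau a.

Lemma contact_dens_mul_integrable (f : R -> R) (K : R) :
  measurable_fun `[tau, T] f -> (forall t, tau <= t <= T -> `|f t| <= K) ->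
  mu.-integrable `[tau, T] (EFin \o (fun s => p s * f s)).
Proof.
move=> mf fK; apply: (@bounded_integrable_itv _ _ _ _ (b * K)).
  by apply: measurable_funM => //; exact: measurable_contact_dens ha.
move=> t tT; rewrite normrM ger0_norm ?(contact_dens_ge0 ha)//.
by rewrite ler_pM ?(contact_dens_ge0 ha) ?(contact_dens_le ha) ?fK.
Qed.

Lemma integral_rate t : t <= T ->
  (\int[mu]_(u in `[tau, t]) (a u)%:E)%E = (A t)%:E.
Proof.
move=> tT; rewrite fineK//; apply: integrable_fin_num => //.
apply: integrableS (rate_integrable ha) => //.
by apply: subset_itvl; rewrite bnd_simp.
Qed.

(** The rate is merely measurable, so integration by parts is carried out as Tonelli on the triangle
    tau <= u <= s <= T: [A s] is expanded as the integral of [a u] over u <= s, and integrating in s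
    first leaves [a u] times the contact mass of [[u, T]]. *)
Lemma integral_abar_contact_dens :
  \int[mu]_(s in `[tau, T]) (A s * p s) =
  1 - expR (- A T) - A T * expR (- A T).
Proof.
have mp := measurable_contact_dens ha.
pose p' := p \_ `[tau, T]; pose a' := a \_ `[tau, T].
have mp' : measurable_fun setT p'.
  exact: (measurable_restrictT p (measurable_itv _)).1.
have ma' : measurable_fun setT a'.
  exact: (measurable_restrictT a (measurable_itv _)).1 ha.1.
have p'0 s : 0 <= p' s.
  rewrite /p' patchE; case: ifPn => // /set_mem/=; rewrite in_itv/=.
  exact: (contact_dens_ge0 ha).
have a'0 s : 0 <= a' s.
  rewrite /a' patchE; case: ifPn => // /set_mem/=; rewrite in_itv/=.
  exact: (rate_ge0 ha).
pose F (x : R * R) : \bar R := (p' x.1 * a' x.2 * (x.2 <= x.1)%R%:R)%:E.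
have mF : measurable_fun setT F.
  apply/measurable_EFinP; apply: measurable_funM.
    by apply: measurable_funM; exact: measurableT_comp.
  apply: (@measurableT_comp _ _ _ _ _ _ (fun t : bool => t%:R : R)) => //.
  exact: measurable_fun_ler.
have F0 x : (0 <= F x)%E by rewrite lee_fin !mulr_ge0.
have e1 : (\int[mu]_(s in `[tau, T]) (A s * p s)%:E =
    \int[mu]_s \int[mu]_u F (s, u))%E.
  rewrite integral_mkcond; apply: eq_integral => s _.
  rewrite patchE; case: ifPn => sT; last first.
    by rewrite integral0_eq// => u _; rewrite /F /p' patchE (negbTE sT) !mul0r.
  move: (sT); rewrite mem_setE in_itv/= => /andP[taus sT'].
  rewrite EFinM -integral_rate// muleC -ge0_integralZl_EFin//; last 3 first.
  - move=> u /=; rewrite in_itv/= => /andP[? us].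
    by rewrite lee_fin (rate_ge0 ha)// (le_trans us)// andbT.
  - apply/measurable_EFinP; apply: measurable_funS ha.1 => //.
    by apply: subset_itvl; rewrite bnd_simp.
  - by apply: (contact_dens_ge0 ha); rewrite taus.
  rewrite integral_mkcond; apply: eq_integral => u _.
  rewrite /F /p' /a' /= !patchE sT !mem_setE !in_itv/=.
  case: (leP u s) => us; rewrite ?andbT ?andbF ?mulr0//.
  rewrite (le_trans us sT') andbT.
  by case: ifP; rewrite ?mulr1 ?mulr0 ?mul0r// EFinM.
have e2 : (\int[mu]_s \int[mu]_u F (s, u) =
    \int[mu]_(u in `[tau, T]) (a u * (expR (- A u) - expR (- A T)))%:E)%E.
  rewrite (fubini_tonelli (m1 := @lebesgue_measure R) (m2 := @lebesgue_measure R) F)//.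
  rewrite [RHS]integral_mkcond; apply: eq_integral => u _.
  rewrite patchE; case: ifPn => uT; last first.
    rewrite integral0_eq// => s _.
    by rewrite /F /a' /= [X in _ * X * _]patchE (negbTE uT) mulr0 mul0r.
  move: (uT); rewrite mem_setE in_itv/= => /andP[tauu uT'].
  rewrite EFinM -(integral_contact_dens ha)// -ge0_integralZl_EFin//; last 3 first.
  - move=> s /=; rewrite in_itv/= => /andP[us sT].
    by rewrite lee_fin (contact_dens_ge0 ha)// sT (le_trans tauu).
  - apply/measurable_EFinP; apply: measurable_funS mp => //.
    by apply: subset_itvr; rewrite bnd_simp.
  - by apply: (rate_ge0 ha); rewrite tauu.
  rewrite [RHS]integral_mkcond; apply: eq_integral => s _.
  rewrite /F /p' /a' /= !patchE uT !mem_setE !in_itv/=.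
  case: (leP u s) => us; rewrite ?andbT ?andbF ?mulr0//.
  rewrite (le_trans tauu us) /=.
  by case: ifP; rewrite ?mulr1 ?mulr0 ?mul0r// -EFinM mulrC.
have ip : mu.-integrable `[tau, T] (EFin \o p).
  apply: (@bounded_integrable_itv _ _ _ _ b) => // t tT.
  by rewrite ger0_norm ?(contact_dens_ge0 ha) ?(contact_dens_le ha).
rewrite /Rintegral [X in fine X = _]e1 e2.
rewrite -/(Rintegral mu `[tau, T] (fun u => a u * (expR (- A u) - expR (- A T)))).
transitivity (\int[mu]_(u in `[tau, T]) (p u - a u * expR (- A T))).
  by apply: eq_Rintegral => u _; rewrite /p /contact_dens mulrBr.
have ia : mu.-integrable `[tau, T] (EFin \o (fun u => a u * expR (- A T))).
  rewrite [X in _.-integrable _ X](_ : _ = fun s => ((a s)%:E * (expR (- A T))%:E)%E).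
    exact: integrableZr (rate_integrable ha).
  by apply/funext => s; rewrite /= EFinM.
rewrite RintegralB; [|exact: measurable_itv|exact: ip|exact: ia].
rewrite [X in _ - X]RintegralZr; [|exact: measurable_itv|exact: rate_integrable ha].
congr (_ - _).
by rewrite /Rintegral (integral_contact_dens ha)// abar_tau oppr0 expR0.
Qed.

(** By [integral_abar_contact_dens] the boundary terms A(T) e^{-A(T)} cancel and the cost is [nu]
    times 1 - e^{-A(T)}, the probability of a contact before [T]. Hence it can be charged as a
    constant [nu] per contact, under the density [p]. *)
Lemma stage_utility_continuation (nu c K : R) (eta V : R -> R) (z : state R) :
  z.2 = tau -> active T z ->
  measurable_fun `[tau, T] eta -> measurable_fun `[tau, T] V ->
  (forall t, tau <= t <= T -> 0 <= eta t <= 1) ->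
  (forall t, tau <= t <= T -> `|V t| <= K) ->
  stage_utility T nu c eta a z + \int[mu]_(s in `[tau, T]) (p s * (eta s * V s)) =
  \int[mu]_(s in `[tau, T]) (p s * (eta s * (c + V s) - nu)).
Proof.
move=> zE az meta mV eta01 VK; rewrite /stage_utility az zE.
have eta1 t : tau <= t <= T -> `|eta t| <= 1.
  by move=> tT; have /andP[e0 e1] := eta01 _ tT; rewrite ger0_norm.
have i1 : mu.-integrable `[tau, T] (EFin \o (fun s => p s * eta s)).
  exact: contact_dens_mul_integrable eta1.
have i2 : mu.-integrable `[tau, T] (EFin \o (fun s => p s * (eta s * V s))).
  apply: (contact_dens_mul_integrable (K := K)); first exact: measurable_funM.
  move=> t tT; rewrite normrM -[leRHS]mul1r ler_pM ?eta1 ?VK//.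
have i3 : mu.-integrable `[tau, T] (EFin \o p).
  apply: (@bounded_integrable_itv _ _ _ _ b) => [|t tT].
    exact: measurable_contact_dens ha.
  by rewrite ger0_norm ?(contact_dens_ge0 ha) ?(contact_dens_le ha).
have i1c : mu.-integrable `[tau, T] (EFin \o (fun s => c * (p s * eta s))).
  rewrite [X in _.-integrable _ X](_ : _ = fun s => (c%:E * (p s * eta s)%:E)%E).
    exact: integrableZl.
  by apply/funext => s; rewrite /= EFinM.
have i3n : mu.-integrable `[tau, T] (EFin \o (fun s => nu * p s)).
  rewrite [X in _.-integrable _ X](_ : _ = fun s => (nu%:E * (p s)%:E)%E).
    exact: integrableZl.
  by apply/funext => s; rewrite /= EFinM.
have i12 : mu.-integrable `[tau, T]
    (EFin \o (fun s => c * (p s * eta s) + p s * (eta s * V s))).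
  rewrite [X in _.-integrable _ X](_ : _ =
      (fun s => (c * (p s * eta s))%:E + (p s * (eta s * V s))%:E)%E).
    exact: (integrableD _ i1c i2).
  by apply/funext => s; rewrite /= EFinD.
transitivity (\int[mu]_(s in `[tau, T])
    (c * (p s * eta s) + p s * (eta s * V s) - nu * p s)); last first.
  by apply: eq_Rintegral => s _; ring.
rewrite RintegralB// RintegralD// !RintegralZl//.
have -> : \int[mu]_(s in `[tau, T]) (eta s * expR (- abar a tau s) * a s) =
   \int[mu]_(s in `[tau, T]) (p s * eta s).
  by apply: eq_Rintegral => s _; rewrite /p /contact_dens; ring.
have -> : \int[mu]_(s in `[tau, T]) (abar a tau s * expR (- abar a tau s) * a s) =
   \int[mu]_(s in `[tau, T]) (A s * p s).
  by apply: eq_Rintegral => s _; rewrite /p /contact_dens /A; ring.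
rewrite integral_abar_contact_dens.
have -> : \int[mu]_(s in `[tau, T]) p s = 1 - expR (- A T).
  by rewrite /Rintegral (integral_contact_dens ha)// abar_tau oppr0 expR0.
rewrite -/(A T); ring.
Qed.

End stage.

(** Composition with the projection of the line onto [[x, y]] gives a function that is monotone
    everywhere and agrees with [f] on the interval. *)
Lemma nonincreasing_in_measurable (R : realType) (x y : R) (f : R -> R) :
  {in `[x, y] &, {homo f : s t /~ s <= t}} -> measurable_fun `[x, y] f.
Proof.
case: (leP x y) => [xy|yx] ndf; last first.
  by rewrite set_itv_ge ?bnd_simp -?ltNge//; exact: measurable_fun_set0.
pose clamp s := Num.max x (Num.min s y).
have clampP s : clamp s \in `[x, y].
  by rewrite in_itv/= le_max lexx /= ge_max xy ge_min lexx orbT.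
apply: (@eq_measurable_fun _ _ _ _ _ (f \o clamp)) => [s|].
  rewrite mem_setE in_itv/= => /andP[xs sy].
  by rewrite /= /clamp (min_idPl sy) (max_idPr xs).
apply: nonincreasing_measurable => // s t st /=; apply: ndf => //.
rewrite /clamp ge_max le_max lexx /= le_max; apply/orP; right.
by rewrite le_min !ge_min st lexx orbT.
Qed.

Lemma threshold_rate_function (R : realType) (T b tau theta : R) : 0 <= b ->
  rate_function T b tau (threshold_policy b theta).
Proof.
move=> b0; split.
  apply: measurable_funTS; apply: measurable_fun_ifT => //.
  exact: measurable_fun_ler.
by move=> t _; rewrite /threshold_policy; case: ifP; rewrite ?lexx ?b0.
Qed.

(** * Optimal value of one stage with a nonincreasing gain *)

Section best_value.
Context (R : realType) (T b K : R) (G : R -> R).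
Hypotheses (b0 : 0 <= b) (ndG : {in `[0, T] &, {homo G : x y /~ x <= y}})
  (GK : forall s, 0 <= s <= T -> 0 <= G s <= K).
Let mu := @lebesgue_measure R.

(** [G] is meant to be the positive part of a gain: the maximal rate may then run up to [T], since
    nothing is lost where the gain is negative, and the formula needs no threshold. *)
Definition best_value (tau : R) : R :=
  \int[mu]_(s in `[tau, T]) (contact_dens tau (cst b) s * G s).

Let mG tau : 0 <= tau -> measurable_fun `[tau, T] G.
Proof.
move=> tau0; apply: (@measurable_funS _ _ _ _ `[0, T]) => //.
  by apply: subset_itvr; rewrite bnd_simp.
exact: nonincreasing_in_measurable.
Qed.

Let G_ge0 s : 0 <= s <= T -> 0 <= G s.
Proof. by move/GK/andP => []. Qed.

Let itv0 tau s : 0 <= tau -> tau <= s <= T -> 0 <= s <= T.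
Proof. by move=> tau0 /andP[taus ->]; rewrite (le_trans tau0). Qed.

Let G_norm tau s : 0 <= tau -> tau <= s <= T -> `|G s| <= K.
Proof.
by move=> tau0 /(itv0 tau0)/GK/andP[g0 gK]; rewrite ger0_norm.
Qed.

Lemma best_value_ge0 tau : 0 <= tau -> 0 <= best_value tau.
Proof.
move=> tau0; apply: Rintegral_ge0 => s /=; rewrite in_itv/= => sT.
rewrite mulr_ge0 ?G_ge0 ?(itv0 tau0)//.
exact: (contact_dens_ge0 (rate_function_cst T tau b0)).
Qed.

Lemma best_value_T : best_value T = 0.
Proof. by rewrite /best_value set_itv1 Rintegral_set1. Qed.

Lemma contact_dens_le_best_value (tau : R) (a : R -> R) : 0 <= tau ->
  rate_function T b tau a ->
  \int[mu]_(s in `[tau, T]) (contact_dens tau a s * G s) <= best_value tau.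
Proof.
move=> tau0 ha; apply: fine_le.
- apply: integrable_fin_num => //.
  exact: (contact_dens_mul_integrable ha (mG tau0) (fun t => @G_norm tau t tau0)).
- apply: integrable_fin_num => //.
  have hb := rate_function_cst T tau b0.
  exact: (contact_dens_mul_integrable hb (mG tau0) (fun t => @G_norm tau t tau0)).
apply: (contact_dens_comparison ha) => //; first exact: mG.
  move=> x y; rewrite !in_itv/= => xT yT; apply: ndG; rewrite in_itv/=.
    exact: itv0 xT.
  exact: itv0 yT.
by move=> s /(itv0 tau0)/G_ge0.
Qed.

(** The contact density has mass at most 1 on [[tau, T]]. *)
Lemma best_value_le tau : 0 <= tau <= T -> best_value tau <= K.
Proof.
move=> /andP[tau0 tauT]; have hb := rate_function_cst T tau b0.
have /GK/andP[/le_trans/[apply] K0] : 0 <= tau <= T by rewrite tau0.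
have md := measurable_contact_dens hb.
have ip : mu.-integrable `[tau, T] (EFin \o contact_dens tau (cst b)).
  apply: (@bounded_integrable_itv _ _ _ _ b) => // t tT.
  by rewrite ger0_norm ?(contact_dens_ge0 hb) ?(contact_dens_le hb).
apply: (@le_trans _ _ (\int[mu]_(s in `[tau, T]) (contact_dens tau (cst b) s * K))).
  apply: le_Rintegral => //.
  - exact: (contact_dens_mul_integrable hb (mG tau0) (fun t => @G_norm tau t tau0)).
  - by apply: (@contact_dens_mul_integrable _ _ _ _ _ hb _ `|K|).
  - move=> s /=; rewrite in_itv/= => sT; apply: ler_wpM2l.
      exact: (contact_dens_ge0 hb).
    by have /andP[] := GK (itv0 tau0 sT).
rewrite RintegralZr// -[leRHS]mul1r ler_wpM2r// /Rintegral.
rewrite (integral_contact_dens hb)//= abar_tau oppr0 expR0.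
by rewrite gerBl expR_ge0.
Qed.

Lemma best_value_nonincreasing :
  {in `[0, T] &, {homo best_value : x y /~ x <= y}}.
Proof.
move=> x y; rewrite !in_itv/= => /andP[x0 xT] /andP[y0 yT] yx.
(* Staying idle on [y, x[ and then using the maximal rate is admissible from y. *)
pose a s := if s < x then 0 else b.
have ha : rate_function T b y a.
  split; last by move=> t _; rewrite /a; case: ifP; rewrite ?lexx ?b0.
  apply: measurable_funTS; apply: measurable_fun_ifT => //.
  exact: measurable_fun_ltr.
apply: le_trans (contact_dens_le_best_value y0 ha).
rewrite /best_value Rintegral_mkcond [leRHS]Rintegral_mkcond le_eqVlt.
apply/orP; left; apply/eqP; apply: eq_Rintegral => s _.
rewrite !patchE !mem_setE !in_itv/= /contact_dens {1}/a.
case: (leP x s) => xs; last by rewrite mul0r mul0r if_same.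
(* Idling adds nothing to the cumulative rate, so from [x] on the two densities coincide. *)
suff -> : abar a y s = abar (cst b) x s by rewrite (le_trans yx xs).
rewrite /abar Rintegral_mkcond [RHS]Rintegral_mkcond; apply: eq_Rintegral => u _.
rewrite !patchE !mem_setE !in_itv/= /a.
case: (leP x u) => xu /=; last by rewrite if_same.
by rewrite (le_trans yx xu).
Qed.

(** Contact densities are nonnegative, so [g] may first be raised to [G]; the comparison of rates
    then applies. *)
Lemma gain_le_best_value (tau K' : R) (a g : R -> R) : 0 <= tau ->
  rate_function T b tau a -> measurable_fun `[tau, T] g ->
  (forall s, tau <= s <= T -> `|g s| <= K') ->
  (forall s, tau <= s <= T -> g s <= G s) ->
  \int[mu]_(s in `[tau, T]) (contact_dens tau a s * g s) <= best_value tau.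
Proof.
move=> tau0 ha mg gK gG.
apply: le_trans (contact_dens_le_best_value tau0 ha).
apply: le_Rintegral => //.
- exact: (contact_dens_mul_integrable ha mg gK).
- exact: (contact_dens_mul_integrable ha (mG tau0) (fun t => @G_norm tau t tau0)).
- move=> s /=; rewrite in_itv/= => sT; apply: ler_wpM2l; last exact: gG.
  exact: (contact_dens_ge0 ha).
Qed.

(** Before [theta] the threshold rate and the maximal rate have the same past, hence the same
    density; after [theta] the threshold rate vanishes on one side and [G] on the other. *)
Lemma threshold_gain (tau theta : R) (g : R -> R) : 0 <= tau ->
  measurable_fun `[tau, T] g ->
  (forall s, tau <= s <= T -> s < theta -> g s = G s) ->
  (forall s, tau <= s <= T -> theta < s -> G s = 0) ->
  \int[mu]_(s in `[tau, T]) (contact_dens tau (threshold_policy b theta) s * g s)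
  = best_value tau.
Proof.
move=> tau0 mg lt_theta gt_theta.
have hb := rate_function_cst T tau b0.
have ha := threshold_rate_function T tau theta b0.
rewrite /best_value /Rintegral.
(* The hypotheses are silent at [theta] itself, so this null point is removed from both
   integrals. *)
have mD : measurable (`[tau, T] `\ theta) by exact: measurableD.
rewrite -[in LHS](@integral_setD1 _ _ theta)//; last first.
  apply/measurable_EFinP; apply: measurable_funS (_ : measurable_fun `[tau, T] _) => //.
  by apply: measurable_funM => //; exact: measurable_contact_dens ha.
rewrite -[in RHS](@integral_setD1 _ _ theta)//; last first.
  apply/measurable_EFinP; apply: measurable_funS (_ : measurable_fun `[tau, T] _) => //.
  apply: measurable_funM; first exact: measurable_contact_dens hb.
  exact: mG.
congr fine; apply: eq_integral => s /set_mem[/=].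
rewrite in_itv/= => sT /= /eqP; rewrite neq_lt => /orP[st|ts]; congr EFin; last first.
  rewrite gt_theta// mulr0 /contact_dens /threshold_policy.
  by rewrite leNgt ts !mul0r.
rewrite (lt_theta s sT st) /contact_dens {1}/threshold_policy (ltW st).
suff -> : abar (threshold_policy b theta) tau s = abar (cst b) tau s by [].
apply: eq_Rintegral => u; rewrite mem_setE in_itv/= => /andP[_ us].
by rewrite /threshold_policy (le_trans us (ltW st)).
Qed.

End best_value.

(** * The transition kernel and the law of the next state *)

Section transition.
Context (R : realType) (T b : R) (eta : R -> R) (q : state R -> R -> R).
Hypothesis hq : forall z : state R, 0 <= z.2 <= T -> rate_function T b z.2 (q z).
Hypothesis mq : measurable_fun
  [set x : state R * R | [/\ 0 <= x.1.2, x.1.2 <= x.2 & x.2 <= T]]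
  (fun x => q x.1 x.2).
Hypothesis meta : measurable_fun `[0, T] eta.
Hypothesis eta01 : forall s, 0 <= s <= T -> 0 <= eta s <= 1.
Let mu := @lebesgue_measure R.

Let dom := [set x : state R * R | [/\ 0 <= x.1.2, x.1.2 <= x.2 & x.2 <= T]].

Let mdom : measurable dom.
Proof.
have m1 : measurable_fun setT (fun x : state R * R => x.1.2).
  by apply: (@measurableT_comp _ _ _ _ _ _ snd).
pose f (x : state R * R) := (0 <= x.1.2) && (x.1.2 <= x.2) && (x.2 <= T).
have -> : dom = f @^-1` [set true].
  apply/seteqP; split => x /=; first by case=> h1 h2 h3; rewrite /f h1 h2 h3.
  by move=> /andP[/andP[h1 h2] h3]; split.
rewrite -[X in measurable X]setTI.
have mf : measurable_fun setT f.
  apply: measurable_and; last exact: measurable_fun_ler.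
  by apply: measurable_and; exact: measurable_fun_ler.
exact: mf.
Qed.

(** Joint measurability of the rates is given on [dom] only; extended by zero they are jointly
    measurable on the whole product, as Tonelli requires. *)
Let qrate : state R * R -> R := (fun x => q x.1 x.2) \_ dom.

Let mqrate : measurable_fun setT qrate.
Proof. exact: (measurable_restrictT _ mdom).1. Qed.

Let qrateE z s : 0 <= z.2 -> z.2 <= s <= T -> qrate (z, s) = q z s.
Proof.
by move=> z0 /andP[zs sT]; rewrite /qrate patchE mem_set//; split.
Qed.

Let qrate_out z s : ~~ [&& 0 <= z.2, z.2 <= s & s <= T] -> qrate (z, s) = 0.
Proof.
move=> h; rewrite /qrate patchE memNset//= => -[h1 h2 h3].
by move: h; rewrite h1 h2 h3.
Qed.

Let qrate_ge0 x : 0 <= qrate x.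
Proof.
case: x => z s.
have [/and3P[h1 h2 h3]|/qrate_out->//] := boolP [&& 0 <= z.2, z.2 <= s & s <= T].
rewrite qrateE ?h2//; apply: (rate_ge0 (hq _)); last by rewrite h2.
by rewrite h1 (le_trans h2).
Qed.

(** The cumulative rate [abar (q z) z.2 s], written as an integral over the whole line to make it
    jointly measurable in state and time. The lower limit [z.2] is hidden in the zero extension
    [qrate]. *)
Let cum (x : state R * R) : R :=
  fine (\int[mu]_u (qrate (x.1, u) * (u <= x.2)%R%:R)%:E).

Let mcum : measurable_fun setT cum.
Proof.
pose F (y : (state R * R) * R) : \bar R := (qrate (y.1.1, y.2) * (y.2 <= y.1.2)%R%:R)%:E.
have mF : measurable_fun setT F.
  apply/measurable_EFinP; apply: measurable_funM.
    apply: (measurableT_comp mqrate); apply: measurable_fun_pair => //=.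
    exact: (measurableT_comp measurable_fst measurable_fst).
  apply: (@measurableT_comp _ _ _ _ _ _ (fun t : bool => t%:R : R)) => //.
  by apply: measurable_fun_ler => //; apply: measurableT_comp.
apply: measurableT_comp => //.
apply: (@measurable_fun_fubini_tonelli_F _ _ _ _ _ (@lebesgue_measure R) F) => //.
by move=> y; rewrite lee_fin mulr_ge0.
Qed.

Let cumE z s : 0 <= z.2 -> z.2 <= s <= T -> cum (z, s) = abar (q z) z.2 s.
Proof.
move=> z0 /andP[zs sT]; rewrite /cum /abar /Rintegral; congr fine.
rewrite [RHS]integral_mkcond; apply: eq_integral => u _ /=.
rewrite patchE mem_setE in_itv/=.
case: (leP u s) => us; rewrite ?andbF ?mulr0// mulr1 andbT.
case: ifPn => zu; first by rewrite qrateE// zu (le_trans us).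
by rewrite qrate_out// (negbTE zu) !andbF.
Qed.

Let dens (x : state R * R) : R := qrate x * expR (- cum x).

Let mdens : measurable_fun setT dens.
Proof.
apply: measurable_funM => //; apply: measurableT_comp => //.
exact: measurableT_comp.
Qed.

Let dens_ge0 x : 0 <= dens x.
Proof. by rewrite mulr_ge0 ?expR_ge0. Qed.

Let densE z s : 0 <= z.2 -> z.2 <= s <= T -> dens (z, s) = contact_dens z.2 (q z) s.
Proof.
move=> z0 sT; rewrite /dens /contact_dens.
by congr (_ * expR (- _)); [exact: qrateE|exact: cumE].
Qed.

Let dens_out z s : 0 <= z.2 -> ~~ (z.2 <= s <= T) -> dens (z, s) = 0.
Proof. by move=> z0 sT; rewrite /dens qrate_out ?mul0r// (negbTE sT) andbF. Qed.

Let eta' : R -> R := eta \_ `[0, T].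

Let meta' : measurable_fun setT eta'.
Proof. exact: (measurable_restrictT _ (measurable_itv _)).1. Qed.

Let eta'E s : 0 <= s <= T -> eta' s = eta s.
Proof. by move=> sT; rewrite /eta' patchE mem_setE in_itv/= sT. Qed.

Let eta'01 s : 0 <= eta' s <= 1.
Proof.
rewrite /eta' patchE; case: ifPn => [/set_mem/=|_]; last by rewrite lexx ler01.
by rewrite in_itv/=; exact: eta01.
Qed.

Local Open Scope ereal_scope.

Let weight (f : state R -> \bar R) (x : state R * R) : \bar R :=
  (dens x)%:E * ((eta' x.2)%:E * f (true, x.2) + (1 - eta' x.2)%:E * f (false, x.2)).

(* The expectation of [f] at the next state, given that the current one is [z]. *)
Let K (f : state R -> \bar R) (z : state R) : \bar R :=
  if active T z then
    \int[mu]_s weight f (z, s) + (expR (- cum (z, T)))%:E * f (true, (T + 1)%R)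
  else f z.

Let mweight f : measurable_fun setT f -> measurable_fun setT (weight f).
Proof.
move=> mf.
have mfl l : measurable_fun setT (fun x : state R * R => f (l, x.2)).
  exact: (measurableT_comp mf (measurable_fun_pair (measurable_cst _) measurable_snd)).
have me : measurable_fun setT (fun x : state R * R => eta' x.2).
  exact: measurableT_comp.
rewrite /weight; apply: emeasurable_funM; first exact/measurable_EFinP.
apply: emeasurable_funD; apply: emeasurable_funM => //.
  exact/measurable_EFinP.
by apply/measurable_EFinP; exact: measurable_funB.
Qed.

Let weight_ge0 f x : (forall z, 0 <= f z) -> 0 <= weight f x.
Proof.
move=> f0; have /andP[e0 e1] := eta'01 x.2.
by rewrite /weight mule_ge0 ?adde_ge0 ?mule_ge0 ?lee_fin ?subr_ge0.
Qed.

Let weightz f z : measurable_fun setT f -> measurable_fun setT (fun s => weight f (z, s)).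
Proof.
move=> mf; apply: (measurableT_comp (mweight mf)).
exact: measurable_pair1.
Qed.

Let mactive : measurable_fun setT (fun z : state R => active T z).
Proof.
apply: measurable_and => //; apply: measurable_and.
  exact: measurable_fun_ler.
exact: measurable_fun_ltr.
Qed.

Let mK f : measurable_fun setT f -> (forall z, 0 <= f z) -> measurable_fun setT (K f).
Proof.
move=> mf f0; apply: measurable_fun_ifT => //.
apply: emeasurable_funD.
  apply: (@measurable_fun_fubini_tonelli_F _ _ _ _ _ (@lebesgue_measure R) (weight f)).
    exact: mweight.
  by move=> x; exact: weight_ge0.
apply: emeasurable_funM => //; apply/measurable_EFinP; apply: measurableT_comp => //.
apply: measurableT_comp => //; apply: (measurableT_comp mcum).
exact: measurable_pair2.
Qed.

Let K_ge0 f z : (forall z, 0 <= f z) -> 0 <= K f z.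
Proof.
move=> f0; rewrite /K; case: ifP => // _.
rewrite adde_ge0 ?mule_ge0 ?lee_fin ?expR_ge0//.
by apply: integral_ge0 => s _; exact: weight_ge0.
Qed.

(** [KD], [KZ], [le_K] and [K_cvg] are, for a fixed current state, the properties that
    [daniell_integral] asks of a functional; integration over the current state preserves them. *)
Let KD f g z : measurable_fun setT f -> measurable_fun setT g ->
  (forall x, 0 <= f x) -> (forall x, 0 <= g x) ->
  K (fun x => f x + g x) z = K f z + K g z.
Proof.
move=> mf mg f0 g0; rewrite /K; case: ifP => // _.
have -> : \int[mu]_s weight (fun x => f x + g x) (z, s) =
    \int[mu]_s (weight f (z, s) + weight g (z, s)).
  apply: eq_integral => s _; have /andP[e0 e1] := eta'01 s.
  rewrite /weight -ge0_muleDr/= ?adde_ge0 ?mule_ge0 ?lee_fin ?subr_ge0//.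
  by congr (_ * _); rewrite !ge0_muleDr// addeACA.
rewrite ge0_integralD//; try (by move=> s _; exact: weight_ge0); try exact: weightz.
by rewrite ge0_muleDr// addeACA.
Qed.

Let KZ r f z : (0 <= r)%R -> measurable_fun setT f ->
  (forall x, 0 <= f x) -> K (fun x => r%:E * f x) z = r%:E * K f z.
Proof.
move=> r0 mf f0; rewrite /K; case: ifP => // _.
have -> : \int[mu]_s weight (fun x => r%:E * f x) (z, s) =
    \int[mu]_s (r%:E * weight f (z, s)).
  apply: eq_integral => s _; have /andP[e0 e1] := eta'01 s.
  rewrite /weight [RHS]muleCA; congr (_ * _).
  by rewrite ge0_muleDr ?mule_ge0 ?lee_fin ?subr_ge0//= !(muleCA r%:E).
rewrite ge0_integralZl_EFin//; [|by move=> s _; exact: weight_ge0|exact: weightz].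
rewrite (muleCA _ r%:E) -ge0_muleDr//; last by rewrite mule_ge0 ?lee_fin ?expR_ge0.
by apply: integral_ge0 => s _; exact: weight_ge0.
Qed.

Let le_weight f g x : (forall z, 0 <= f z) -> (forall z, f z <= g z) -> weight f x <= weight g x.
Proof.
move=> f0 fg; have /andP[e0 e1] := eta'01 x.2.
rewrite /weight lee_wpmul2l ?lee_fin// leeD// lee_wpmul2l ?lee_fin//.
by rewrite subr_ge0.
Qed.

Let le_K f g z : measurable_fun setT f -> measurable_fun setT g ->
  (forall z, 0 <= f z) -> (forall z, f z <= g z) -> K f z <= K g z.
Proof.
move=> mf mg f0 fg; rewrite /K; case: ifP => // _.
rewrite leeD// ?lee_wpmul2l ?lee_fin ?expR_ge0//.
apply: ge0_le_integral => //; [by move=> s _; exact: weight_ge0|exact: weightz|exact: weightz|].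
by move=> s _; exact: le_weight.
Qed.

Let K_cvg (f : (state R -> \bar R)^nat) z :
  (forall n, measurable_fun setT (f n)) -> (forall n x, 0 <= f n x) ->
  (forall x, nondecreasing_seq (f ^~ x)) ->
  K (f n) z @[n --> \oo] --> K (fun x => limn (f ^~ x)) z.
Proof.
move=> mf f0 ndf; have fcvg x : f n x @[n --> \oo] --> limn (f ^~ x).
  by apply: ereal_nondecreasing_is_cvgn.
have lim0 x : 0 <= limn (f ^~ x).
  by apply: lime_ge; [exact: ereal_nondecreasing_is_cvgn|exact: nearW].
rewrite /K; case: ifP => // _.
have wcvg s : weight (f n) (z, s) @[n --> \oo] --> weight (fun x => limn (f ^~ x)) (z, s).
  have /andP[e0 e1] := eta'01 s.
  apply: cvgeZl => //; apply: cvgeD; [|exact: cvgeZl|exact: cvgeZl].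
  by rewrite ge0_adde_def// inE mule_ge0// lee_fin ?subr_ge0.
apply: cvgeD.
- rewrite ge0_adde_def// inE ?mule_ge0 ?lee_fin ?expR_ge0//.
  by apply: integral_ge0 => s _; exact: weight_ge0.
- rewrite (_ : (fun s => _) = fun s => limn (fun n => weight (f n) (z, s))); last first.
    by apply/funext => s; exact/esym/cvg_lim.
  apply: cvg_monotone_convergence => //.
  + by move=> n; exact: weightz.
  + by move=> n s _; exact: weight_ge0.
  + by move=> s _ n m nm; apply: le_weight => // x; exact: ndf.
- exact: cvgeZl.
Qed.

Let next_stateE z A : next_state T eta (q z) z A = K (fun x => (\1_A x)%:E) z.
Proof.
rewrite /next_state /K; have [|az] := boolP (active T z); last first.
  by rewrite diracE indicE.
move=> /andP[_ /andP[z0 zT]].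
have TT : (z.2 <= T <= T)%R by rewrite ltW//= lexx.
rewrite cumE//; congr (_ + _).
rewrite integral_mkcond; apply: eq_integral => s _.
rewrite patchE mem_setE in_itv/= /weight /=.
case: ifPn => sT; last by rewrite dens_out// mul0e.
rewrite densE// eta'E; last by move: sT => /andP[/(le_trans z0)-> ->].
by rewrite !EFinM !EFinD !EFinM.
Qed.

Lemma measurable_active_fun (V : R -> R) : measurable_fun `[0%R, T] V ->
  measurable_fun setT (fun z : state R => if active T z then V z.2 else 0%R).
Proof.
move=> mV; pose V' := V \_ `[0%R, T].
have mV' : measurable_fun setT V' by exact: (measurable_restrictT V (measurable_itv _)).1.
rewrite (_ : (fun _ => _) = fun z : state R => if active T z then V' z.2 else 0%R).
  by apply: measurable_fun_ifT => //; exact: (measurableT_comp mV' measurable_snd).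
apply/funext => z; case: ifPn => // /andP[_ /andP[z0 zT]].
by rewrite /V' patchE mem_setE in_itv/= z0 ltW.
Qed.

(** The mass 1 - e^{-abar(T)} of a contact and the mass e^{-abar(T)} of no contact add up to 1, so
    the total mass is preserved from one epoch to the next. *)
Let K1 z : K (cst 1) z = 1.
Proof.
rewrite /K; case: ifPn => [/andP[_ /andP[z0 zT]]|//].
have hz : rate_function T b z.2 (q z) by apply: hq; rewrite z0 ltW.
have -> : \int[mu]_s weight (cst 1) (z, s) =
    \int[mu]_(s in `[z.2, T]) (contact_dens z.2 (q z) s)%:E.
  rewrite [RHS]integral_mkcond; apply: eq_integral => s _.
  rewrite patchE mem_setE in_itv/= /weight /= !mule1 -EFinD subrKC mule1.
  by case: ifPn => sT; [rewrite densE|rewrite dens_out].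
rewrite (integral_contact_dens hz)// ?ltW// abar_tau oppr0 expR0.
have TT : (z.2 <= T <= T)%R by rewrite ltW//= lexx.
by rewrite cumE//= mule1 -EFinD subrK.
Qed.

(** The expected value of [V] at the next state: only a successful contact, of probability [eta s],
    leads to an active state, and every other outcome is worth 0. *)
Definition continuation (V : R -> R) (z : state R) : R :=
  if active T z then
    (\int[mu]_(s in `[z.2, T]) (contact_dens z.2 (q z) s * (eta s * V s)))%R
  else 0%R.

Let K_active (V : R -> R) (B : R) (z : state R) : measurable_fun `[0%R, T] V ->
  (forall s, (0 <= s <= T)%R -> (0 <= V s <= B)%R) -> V T = 0%R ->
  K (fun z' => (if active T z' then V z'.2 else 0%R)%:E) z = (continuation V z)%:E.
Proof.
move=> mV VB VT; rewrite /K /continuation.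
case: ifPn => [/andP[_ /andP[z0 zT]]|/negbTE->//].
have hz : rate_function T b z.2 (q z) by apply: hq; rewrite z0 ltW.
have sub0 : `[z.2, T] `<=` `[0%R, T] by apply: subset_itvr; rewrite bnd_simp.
have z0s s : (z.2 <= s <= T)%R -> (0 <= s <= T)%R.
  by move=> /andP[zs ->]; rewrite (le_trans z0).
have i1 : mu.-integrable `[z.2, T]
    (EFin \o (fun s => contact_dens z.2 (q z) s * (eta s * V s))%R).
  apply: (@contact_dens_mul_integrable _ _ _ _ _ hz _ B).
    by apply: measurable_funM; [exact: measurable_funS meta|exact: measurable_funS mV].
  move=> s /z0s s0; have /andP[e0 e1] := eta01 s0; have /andP[v0 v1] := VB _ s0.
  by rewrite ger0_norm ?mulr_ge0// -[leRHS]mul1r ler_pM.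
(* The state [(true, T + 1)] that encodes the absence of a contact is not active, so its atom
   contributes 0. *)
rewrite /active/= ltNge lerDl ler01 andbF mule0 adde0.
rewrite -[RHS]/(fine _)%:E fineK; last exact: integrable_fin_num.
rewrite [RHS]integral_mkcond; apply: eq_integral => s _.
rewrite patchE mem_setE in_itv/= /weight /=.
case: (boolP (z.2 <= s <= T)%R) => sT; last by rewrite dens_out// mul0e.
have s0 := z0s _ sT; have /andP[s0' sT'] := s0.
rewrite densE// eta'E// mule0 adde0 s0'/= -!EFinM; congr (_%:E).
(* A contact exactly at [T] leads to an inactive state, while the integrand carries [V T]; the two
   agree because [V T = 0]. *)
have [//|Ts] := ltP s T.
by rewrite (_ : s = T) ?VT//; apply/le_anti; rewrite sT' Ts.
Qed.

Lemma measurable_continuation (V : R -> R) (B : R) : measurable_fun `[0%R, T] V ->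
  (forall s, (0 <= s <= T)%R -> (0 <= V s <= B)%R) -> V T = 0%R ->
  measurable_fun setT (continuation V).
Proof.
move=> mV VB VT; apply/measurable_EFinP.
rewrite (_ : EFin \o _ = K (fun z' => (if active T z' then V z'.2 else 0%R)%:E)).
  apply: mK; first by apply/measurable_EFinP; exact: measurable_active_fun.
  move=> z; rewrite lee_fin; case: ifPn => // /andP[_ /andP[z0 zT]].
  by have /andP[] := VB z.2 (introT andP (conj z0 (ltW zT))).
by apply/funext => z; rewrite (K_active _ mV VB VT).
Qed.

(** In terms of [dens] and [cum] all integrals run over the whole line with jointly measurable
    nonnegative integrands, so Tonelli gives measurability in the state. *)
Lemma measurable_stage_utility (nu c : R) :
  measurable_fun setT (fun z => stage_utility T nu c eta (q z) z).
Proof.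
have cum_ge0 x : (0 <= cum x)%R.
  by apply/fine_ge0/integral_ge0 => u _; rewrite lee_fin mulr_ge0.
have mI (h : state R * R -> R) : measurable_fun setT h -> (forall x, (0 <= h x)%R) ->
    measurable_fun setT (fun z => fine (\int[mu]_s (dens (z, s) * h (z, s))%:E)).
  move=> mh h0; apply: measurableT_comp => //.
  apply: (@measurable_fun_fubini_tonelli_F _ _ _ _ _ (@lebesgue_measure R)
    (fun x => (dens x * h x)%:E)).
    by apply/measurable_EFinP; exact: measurable_funM.
  by move=> x; rewrite lee_fin mulr_ge0.
have m_eta : measurable_fun setT (fun x : state R * R => eta' x.2).
  exact: (measurableT_comp meta' measurable_snd).
have mcT : measurable_fun setT (fun z => cum (z, T)).
  by apply: (measurableT_comp mcum); exact: measurable_pair2.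
rewrite (_ : (fun _ => _) = fun z => if active T z then
    (c * fine (\int[mu]_s (dens (z, s) * eta' s)%:E) -
    nu * (cum (z, T) * expR (- cum (z, T)) +
      fine (\int[mu]_s (dens (z, s) * cum (z, s))%:E)))%R
  else 0%R).
  apply: measurable_fun_ifT => //.
  apply: measurable_funB; apply: measurable_funM => //.
    by apply: (mI (fun x => eta' x.2)) => // x; have /andP[] := eta'01 x.2.
  apply: measurable_funD; last exact: mI.
  apply: measurable_funM => //; apply: measurableT_comp => //.
  exact: measurableT_comp.
apply/funext => z; rewrite /stage_utility; case: ifPn => // /andP[_ /andP[z0 zT]].
have eqI (h g : R -> R) :
    (forall s, (z.2 <= s <= T)%R -> g s = (contact_dens z.2 (q z) s * h s)%R) ->
    (\int[mu]_(s in `[z.2, T]) g s)%R = fine (\int[mu]_s (dens (z, s) * h s)%:E).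
  move=> gh; rewrite /Rintegral integral_mkcond; congr fine; apply: eq_integral => s _.
  rewrite patchE mem_setE in_itv/=; case: ifPn => sT; last by rewrite dens_out// mul0r.
  by rewrite (gh _ sT) (densE z0 sT).
have TT : (z.2 <= T <= T)%R by rewrite ltW//= lexx.
rewrite (eqI eta'); last first.
  move=> s sT; rewrite eta'E; first by rewrite /contact_dens; ring.
  by have /andP[/(le_trans z0)-> ->] := sT.
rewrite (eqI (fun s => cum (z, s))); last first.
  by move=> s sT; rewrite cumE// /contact_dens; ring.
by rewrite cumE.
Qed.

(** [daniell_integral] is applied to the functional that integrates [K f] against [m]. The last
    clause is the tower property, for value functions set to 0 on inactive states. *)
Lemma next_law (m : {measure set (state R) -> \bar R}) :
  exists m' : {measure set (state R) -> \bar R}, [/\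
    (m' : set (state R) -> \bar R) =
      (fun A => \int[m]_z next_state T eta (q z) z A),
    m' setT = m setT &
    forall (V : R -> R) (B : R), measurable_fun `[0%R, T] V ->
      (forall s, (0 <= s <= T)%R -> (0 <= V s <= B)%R) -> V T = 0%R ->
      \int[m']_z (if active T z then V z.2 else 0%R)%:E =
      \int[m]_z (continuation V z)%:E].
Proof.
have [|f g mf mg f0 g0|r f r0 mf f0|f mf f0 ndf|A|m' m'E m'I] :=
  @daniell_integral _ _ R (fun f => \int[m]_z K f z) _ _ _ _
    (fun A => \int[m]_z next_state T eta (q z) z A).
- by move=> f f0; apply: integral_ge0 => z _; exact: K_ge0.
- under eq_integral do rewrite KD//.
  by rewrite ge0_integralD//; try (by move=> z _; exact: K_ge0); exact: mK.
- under eq_integral do rewrite KZ//.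
  by rewrite ge0_integralZl_EFin//; [move=> z _; exact: K_ge0|exact: mK].
- rewrite (_ : (fun z => K _ z) = fun z => limn (fun n => K (f n) z)); last first.
    by apply/funext => z; apply/esym/cvg_lim => //; exact: K_cvg.
  apply: cvg_monotone_convergence => //.
  + by move=> n; exact: mK.
  + by move=> n z _; exact: K_ge0.
  + by move=> z _ i j ij; apply: le_K => // x; exact: ndf.
- by apply: eq_integral => z _; rewrite next_stateE.
exists m'; split => //.
  have mass (n : {measure set (state R) -> \bar R}) : n setT = \int[n]_z cst 1 z.
    by rewrite integral_cst// mul1e.
  rewrite !mass m'I//.
  by apply: eq_integral => z _; exact: K1.
move=> V B mV VB VT; rewrite m'I.
- by apply: eq_integral => z _; rewrite (K_active _ mV VB VT).
- by apply/measurable_EFinP; exact: measurable_active_fun.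
- move=> z; rewrite lee_fin; case: ifPn => // /andP[_ /andP[z0 zT]].
  by have /andP[] := VB z.2 (introT andP (conj z0 (ltW zT))).
Qed.

End transition.

(** Again because a contact density has mass at most 1. *)
Lemma contact_dens_mul_le (R : realType) (T b tau K : R) (a f : R -> R) :
  rate_function T b tau a -> tau <= T -> measurable_fun `[tau, T] f ->
  (forall t, tau <= t <= T -> `|f t| <= K) ->
  `|\int[lebesgue_measure]_(s in `[tau, T]) (contact_dens tau a s * f s)| <= K.
Proof.
move=> ha tauT mf fK; have i1 := contact_dens_mul_integrable ha mf fK.
have K0 : 0 <= K by apply: le_trans (fK tau _) => //; rewrite lexx.
have ip : lebesgue_measure.-integrable `[tau, T] (EFin \o contact_dens tau a).
  apply: (@bounded_integrable_itv _ _ _ _ b) => [|t tT].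
    exact: measurable_contact_dens ha.
  by rewrite ger0_norm ?(contact_dens_ge0 ha) ?(contact_dens_le ha).
apply: le_trans (le_normr_Rintegral _ i1) _ => //.
apply: (@le_trans _ _ (\int[lebesgue_measure]_(s in `[tau, T]) (contact_dens tau a s * K))).
  apply: le_Rintegral => //.
  - exact: integrable_norm.
  - apply: (@contact_dens_mul_integrable _ _ _ _ _ ha _ K) => // t _.
    by rewrite ger0_norm.
  - move=> s /=; rewrite in_itv/= => sT.
    rewrite normrM ger0_norm ?(contact_dens_ge0 ha)//.
    by rewrite ler_wpM2l ?(contact_dens_ge0 ha)// fK.
rewrite RintegralZr// -[leRHS]mul1r ler_wpM2r// /Rintegral.
rewrite (integral_contact_dens ha)//= abar_tau oppr0 expR0.
by rewrite gerBl expR_ge0.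
Qed.

(** * Backward induction over the epochs *)

Section dynamic_programming.
Context (R : realType) (T nu b : R) (c : nat -> R) (eta : nat -> R -> R).
Hypotheses (T0 : 0 < T) (nu0 : 0 < nu) (b0 : 0 < b).
Hypothesis nd_eta : forall k, {in `[0, T] &, {homo eta k : x y /~ x <= y}}.
Hypothesis eta01 : forall k s, 0 <= s <= T -> 0 <= eta k s <= 1.
Let mu := @lebesgue_measure R.

Let meta k : measurable_fun `[0, T] (eta k).
Proof. exact: nonincreasing_in_measurable. Qed.

Definition gain (k : nat) (V : R -> R) (s : R) : R := eta k s * (c k + V s) - nu.

Definition gain_pos (k : nat) (V : R -> R) (s : R) : R := Num.max (gain k V s) 0.

(** The invariants of the backward induction: monotonicity yields a single switching time, the value
    0 at [T] treats a contact at the deadline as inactive, and the bounds give integrability. *)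
Definition admissible_value (V : R -> R) : Prop :=
  [/\ {in `[0, T] &, {homo V : x y /~ x <= y}}, V T = 0 &
      exists B, forall s, 0 <= s <= T -> 0 <= V s <= B].

Let gain_pos_ge0 (k : nat) (V : R -> R) (s : R) : 0 <= gain_pos k V s.
Proof. by rewrite /gain_pos le_max lexx orbT. Qed.

(** The reward [c k] may be negative, in which case the gain itself need not be monotone. Where the
    gain is positive, however, [nu > 0] forces [c k + V] to be nonnegative, and going back in time
    both nonnegative factors [eta k] and [c k + V] can only grow. *)
Lemma gain_pos_nonincreasing (k : nat) (V : R -> R) : admissible_value V ->
  {in `[0, T] &, {homo gain_pos k V : x y /~ x <= y}}.
Proof.
case=> ndV _ _ x y; rewrite !in_itv/= => xT yT yx.
have [gx0|gx0] := leP (gain k V x) 0.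
  by rewrite /gain_pos (max_idPr gx0) gain_pos_ge0.
rewrite /gain_pos ge_max !le_max lexx orbT andbT; apply/orP; left.
have xI : x \in `[0, T] by rewrite in_itv.
have yI : y \in `[0, T] by rewrite in_itv.
have Vyx := ndV _ _ xI yI yx; have eyx := nd_eta k xI yI yx.
have /andP[ex0 _] := eta01 k xT.
have cx0 : 0 <= c k + V x.
  rewrite leNgt; apply/negP => cx0; move: gx0; rewrite ltNge => /negP; apply.
  rewrite /gain subr_le0 (le_trans _ (ltW nu0))// nmulr_lle0//.
by rewrite /gain lerD2r ler_pM// lerD2l.
Qed.

Let gain_norm (k : nat) (V : R -> R) (B s : R) : 0 <= s <= T -> 0 <= V s <= B ->
  `|gain k V s| <= `|c k| + B + nu.
Proof.
move=> sT /andP[V0 VB]; have /andP[e0 e1] := eta01 k sT.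
rewrite (le_trans (ler_normB _ _))// (gtr0_norm nu0) lerD2r normrM -[leRHS]mul1r.
rewrite ler_pM// ?(ger0_norm e0)// (le_trans (ler_normD _ _))// lerD2l.
by rewrite ger0_norm.
Qed.

Let gain_pos_bound (k : nat) (V : R -> R) (B s : R) : 0 <= s <= T -> 0 <= V s <= B ->
  0 <= gain_pos k V s <= `|c k| + B + nu.
Proof.
move=> sT VB; rewrite gain_pos_ge0 /= /gain_pos ge_max.
have gn := gain_norm k sT VB.
by rewrite (le_trans (ler_norm _) gn) (le_trans _ gn).
Qed.

Lemma admissible_best_value (k : nat) (V : R -> R) : admissible_value V ->
  admissible_value (best_value T b (gain_pos k V)).
Proof.
move=> aV; have ndG := gain_pos_nonincreasing k aV.
case: aV => _ _ [B VB].
have GB s : 0 <= s <= T -> 0 <= gain_pos k V s <= `|c k| + B + nu.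
  by move=> sT; exact/gain_pos_bound/VB.
split.
- exact: (best_value_nonincreasing (ltW b0) ndG GB).
- exact: best_value_T.
- exists (`|c k| + B + nu) => s sT; have /andP[s0 _] := sT.
  by rewrite (best_value_ge0 (ltW b0) GB)// (best_value_le (ltW b0) ndG GB).
Qed.

(** Adjoining 0 keeps the set nonempty when the gain is nowhere positive; the supremum is then 0. *)
Definition switch_time (k : nat) (V : R -> R) : R :=
  sup [set s | 0 <= s <= T /\ (s = 0 \/ 0 < gain k V s)].

Let switch_has_sup (k : nat) (V : R -> R) :
  has_sup [set s | 0 <= s <= T /\ (s = 0 \/ 0 < gain k V s)].
Proof.
by split; [exists 0; split; [rewrite lexx ltW|left]|exists T => s [/andP[]]].
Qed.

Lemma switch_time_itv (k : nat) (V : R -> R) : 0 <= switch_time k V <= T.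
Proof.
have [ne ub] := switch_has_sup k V; apply/andP; split.
  by apply: (ub_le_sup ub); split; [rewrite lexx ltW|left].
by apply: ge_sup => // s [/andP[]].
Qed.

(** Some point beyond [s] has positive gain, and monotonicity of the positive part carries
    positivity back to [s]. *)
Lemma gain_lt_switch_time (k : nat) (V : R -> R) (s : R) :
  admissible_value V -> 0 <= s <= T ->
  s < switch_time k V -> gain k V s = gain_pos k V s.
Proof.
move=> aV sT /(sup_gt (switch_has_sup k V).1)[t [tT t_gt] st].
have gt0 : 0 < gain k V t.
  case: t_gt => // tE; move: st; rewrite tE ltNge; by case/andP: sT => ->.
have : gain_pos k V t <= gain_pos k V s.
  by apply: gain_pos_nonincreasing; rewrite ?in_itv//= ltW.
rewrite {1}/gain_pos (max_idPl (ltW gt0)) => /(lt_le_trans gt0).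
rewrite /gain_pos lt_max ltxx orbF => /ltW gs0.
by rewrite (max_idPl gs0).
Qed.

Lemma gain_gt_switch_time (k : nat) (V : R -> R) (s : R) : 0 <= s <= T ->
  switch_time k V < s -> gain_pos k V s = 0.
Proof.
move=> sT; have [ne ub] := switch_has_sup k V.
have [g0 _|g0] := leP (gain k V s) 0; first exact/max_idPr.
by rewrite ltNge => /negP[]; apply: (ub_le_sup ub); split => //; right.
Qed.

Section stage.
Variables (k : nat) (V : R -> R) (q : state R -> R -> R).
Hypothesis aV : admissible_value V.
Hypothesis hq : forall z : state R, 0 <= z.2 <= T -> rate_function T b z.2 (q z).

Let mV : measurable_fun `[0, T] V.
Proof. by case: aV => ndV _ _; exact: nonincreasing_in_measurable. Qed.

Let sub0 (z : state R) : 0 <= z.2 -> `[z.2, T] `<=` `[0, T].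
Proof. by move=> z0; apply: subset_itvr; rewrite bnd_simp. Qed.

Let in0 (z : state R) s : 0 <= z.2 -> z.2 <= s <= T -> 0 <= s <= T.
Proof. by move=> z0 /andP[zs ->]; rewrite (le_trans z0). Qed.

Let stage_gain (z : state R) : active T z ->
  stage_utility T nu (c k) (eta k) (q z) z + continuation T (eta k) q V z =
  \int[mu]_(s in `[z.2, T]) (contact_dens z.2 (q z) s * gain k V s).
Proof.
move=> az; have /andP[_ /andP[z0 zT]] := az; have [_ _ [B VB]] := aV.
have hz : rate_function T b z.2 (q z) by apply: hq; rewrite z0 ltW.
rewrite /continuation az.
apply: (stage_utility_continuation hz (ltW zT) nu (c k) (K := B)) => //.
- exact: measurable_funS (sub0 z0) (meta k).
- exact: measurable_funS (sub0 z0) mV.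
- by move=> t /(in0 z0)/eta01.
- by move=> t /(in0 z0)/VB/andP[v0 vB]; rewrite ger0_norm.
Qed.

Let mgain (z : state R) : 0 <= z.2 -> measurable_fun `[z.2, T] (gain k V).
Proof.
move=> z0; apply: measurable_funB => //; apply: measurable_funM.
  exact: measurable_funS (sub0 z0) (meta k).
by apply: measurable_funD => //; exact: measurable_funS (sub0 z0) mV.
Qed.

(** The Bellman inequality, valid for any admissible rates; on active states it is the one-stage
    bound for the gain, and on inactive ones both sides are 0. *)
Lemma stage_le_best_value (z : state R) :
  stage_utility T nu (c k) (eta k) (q z) z + continuation T (eta k) q V z <=
  if active T z then best_value T b (gain_pos k V) z.2 else 0.
Proof.
have [az|naz] := boolP (active T z); last first.
  by rewrite /stage_utility /continuation (negbTE naz) addr0.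
have /andP[_ /andP[z0 zT]] := az; rewrite stage_gain//.
have [_ _ [B VB]] := aV.
have hz : rate_function T b z.2 (q z) by apply: hq; rewrite z0 ltW.
have GB s : 0 <= s <= T -> 0 <= gain_pos k V s <= `|c k| + B + nu.
  by move=> sT; exact/gain_pos_bound/VB.
have gB s : z.2 <= s <= T -> `|gain k V s| <= `|c k| + B + nu.
  by move=> /(in0 z0) s0; exact/gain_norm/VB.
have ndG := gain_pos_nonincreasing k aV.
apply: (gain_le_best_value (ltW b0) ndG GB z0 hz (mgain z0) gB) => s _.
by rewrite /gain_pos le_max lexx.
Qed.

Lemma stage_eq_best_value (z : state R) :
  (active T z -> q z = threshold_policy b (switch_time k V)) ->
  stage_utility T nu (c k) (eta k) (q z) z + continuation T (eta k) q V z =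
  if active T z then best_value T b (gain_pos k V) z.2 else 0.
Proof.
have [az /(_ isT) qE|naz _] := boolP (active T z); last first.
  by rewrite /stage_utility /continuation (negbTE naz) addr0.
have /andP[_ /andP[z0 zT]] := az; rewrite stage_gain// qE.
have ndG := gain_pos_nonincreasing k aV.
apply: (threshold_gain (ltW b0) ndG z0 (mgain z0)) => s /(in0 z0) s0.
  exact: gain_lt_switch_time.
exact: gain_gt_switch_time.
Qed.

(** The case [V = 0] of [stage_utility_continuation] writes the stage utility as an integral of eta
    c - nu against a density of mass at most 1. *)
Lemma stage_utility_norm (z : state R) :
  `|stage_utility T nu (c k) (eta k) (q z) z| <= `|c k| + nu.
Proof.
have [az|naz] := boolP (active T z); last first.
  by rewrite /stage_utility (negbTE naz) normr0 addr_ge0// ltW.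
have /andP[_ /andP[z0 zT]] := az.
have hz : rate_function T b z.2 (q z) by apply: hq; rewrite z0 ltW.
have me := measurable_funS (measurable_itv _) (sub0 z0) (meta k).
have := stage_utility_continuation hz (ltW zT) nu (c k) (K := 0) (V := cst 0) erefl az me.
move=> /(_ (measurable_cst _)) /(_ (fun t tT => eta01 k (in0 z0 tT))).
have z_norm t : z.2 <= t <= T -> `|cst 0 t : R| <= 0 by rewrite normr0.
move=> /(_ z_norm).
have -> : \int[mu]_(s in `[z.2, T]) (contact_dens z.2 (q z) s * (eta k s * cst 0 s)) = 0.
  under eq_Rintegral do rewrite mulr0 mulr0.
  by rewrite Rintegral_cst// mul0r.
rewrite addr0 => ->; apply: (contact_dens_mul_le hz (ltW zT)).
  by apply: measurable_funB => //; apply: measurable_funM => //; exact: measurable_funD.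
move=> t /(in0 z0) t0; have := gain_norm (V := cst 0) (B := 0) k t0.
by rewrite addr0; apply; rewrite lexx.
Qed.

Lemma continuation_norm : exists B, forall z : state R, `|continuation T (eta k) q V z| <= B.
Proof.
have [_ _ [B VB]] := aV; exists B => z; rewrite /continuation.
have B0 : 0 <= B.
  by have /andP[/le_trans/[apply]] : 0 <= V 0 <= B by apply: VB; rewrite lexx ltW.
case: ifPn => [/andP[_ /andP[z0 zT]]|_]; last by rewrite normr0.
have hz : rate_function T b z.2 (q z) by apply: hq; rewrite z0 ltW.
apply: (contact_dens_mul_le hz (ltW zT)).
  apply: measurable_funM; first exact: measurable_funS (sub0 z0) (meta k).
  exact: measurable_funS (sub0 z0) mV.
move=> t /(in0 z0) t0; have /andP[e0 e1] := eta01 k t0; have /andP[v0 v1] := VB _ t0.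
by rewrite ger0_norm ?mulr_ge0// -[leRHS]mul1r ler_pM.
Qed.

End stage.

Variable M : nat.

(* Indexed by the number of remaining epochs: [value j] is the value function
   of epoch [M - j + 1]. *)
Fixpoint value (j : nat) : R -> R :=
  if j is j'.+1 then best_value T b (gain_pos (M - j') (value j')) else cst 0.

Lemma admissible_value_value j : admissible_value (value j).
Proof.
elim: j => [|j IH]; last exact: admissible_best_value.
by split => //=; exists 0 => s _; rewrite lexx.
Qed.

Lemma state_law_measure (p : policy R) (j : nat) : strategy M T b p -> (j <= M)%N ->
  exists m : {measure set (state R) -> \bar R},
    (m : set (state R) -> \bar R) = state_law T eta p j /\ m setT = 1%E.
Proof.
move=> hp; elim: j => [|j IH] jM.
  by exists \d_((true, 0) : state R); rewrite /= diracT.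
have [m [mE m1]] := IH (ltnW jM).
have [hq mq] := hp j.+1 jM.
have [m' [m'E m'1 _]] := next_law hq mq (meta j.+1) (eta01 j.+1) m.
by exists m'; rewrite m'1 m1; split => //=; rewrite m'E mE.
Qed.

Definition tail_utility (p : policy R) (j : nat) : \bar R :=
  (\sum_((M - j).+1 <= k < M.+1) \int[state_law T eta p k.-1]_z
     (stage_utility T nu (c k) (eta k) (p k z) z)%:E)%E.

(** [state_law] at index [M - j] is the law at epoch [M - j + 1], the first of the last [j]
    epochs. *)
Definition tail_value (p : policy R) (j : nat) : \bar R :=
  (\int[state_law T eta p (M - j)]_z
     (if active T z then value j z.2 else 0)%:E)%E.

(** Induction on [j]: the earliest remaining epoch is split off, [next_law] turns the later tail
    value into an expected continuation, and the Bellman inequality is integrated against the state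
    law. Bound and equality share this computation and are proved together. *)
Lemma tail_utility_value (p : policy R) (j : nat) : strategy M T b p -> (j <= M)%N ->
  (tail_utility p j <= tail_value p j)%E /\
  ((forall k (z : state R), (1 <= k <= M)%N -> active T z ->
      p k z = threshold_policy b (switch_time k (value (M - k)))) ->
    tail_utility p j = tail_value p j).
Proof.
move=> hp; elim: j => [|j IH] jM.
  have -> : tail_value p 0 = 0%E.
    have [m [mE _]] := state_law_measure hp (leq_subr 0 M).
    by rewrite /tail_value -mE; apply: integral0_eq => z _; rewrite if_same.
  by rewrite /tail_utility subn0 big_geq.
have [tail_le tail_eq] := IH (ltnW jM).
(* The first of the last [j + 1] epochs has number [M - j]. *)
set k := (M - j)%N.
have kM : (1 <= k <= M)%N by rewrite /k leq_subr subn_gt0 jM.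
have Mj : (M - j.+1)%N = k.-1 by rewrite subnS.
have Mk : (M - k)%N = j by rewrite subKn// ltnW.
have kS : k.-1.+1 = k by rewrite prednK//; case/andP: kM.
have [hq mq] := hp k kM.
have aV := admissible_value_value j; have [ndV VT [B VB]] := aV.
have mV := nonincreasing_in_measurable ndV.
have [m [mE m1]] : exists m : {measure set (state R) -> \bar R},
    (m : set (state R) -> \bar R) = state_law T eta p k.-1 /\ m setT = 1%E.
  by apply: state_law_measure => //; rewrite -Mj leq_subr.
have [m' [m'E _ m'V]] := next_law hq mq (meta k) (eta01 k) m.
pose r z := stage_utility T nu (c k) (eta k) (p k z) z.
pose ct := continuation T (eta k) (p k) (value j).
have tailE : tail_utility p j.+1 = (\int[m]_z (r z)%:E + tail_utility p j)%E.
  by rewrite /tail_utility Mj kS big_ltn ?mE//; case/andP: kM.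
have optE : tail_value p j.+1 = (\int[m]_z (if active T z then value j.+1 z.2 else 0)%:E)%E.
  by rewrite /tail_value Mj mE.
have opt'E : tail_value p j = (\int[m]_z (ct z)%:E)%E.
  by rewrite -(m'V _ B)// m'E mE /tail_value -/k -kS.
(* Stage utilities can be negative, so splitting the integral of a sum requires integrability; it
   follows from boundedness, as [m] has mass 1. *)
have bounded_int (f : state R -> R) (K : R) : measurable_fun setT f ->
    (forall z, `|f z| <= K) -> m.-integrable setT (EFin \o f).
  move=> mf fK; apply: measurable_bounded_integrable => //.
    by rewrite m1 ltry.
  exists K; split; first exact: num_real.
  by move=> x Kx z _ /=; rewrite (le_trans (fK z))// ltW.
have ir : m.-integrable setT (EFin \o r).
  apply: bounded_int (stage_utility_norm k hq).
  exact: measurable_stage_utility hq mq (meta k) (eta01 k) _ _.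
have ict : m.-integrable setT (EFin \o ct).
  have [K ctK] := continuation_norm k aV hq.
  have mct := measurable_continuation hq mq (meta k) (eta01 k) mV VB VT.
  exact: bounded_int mct ctK.
have sumE : (\int[m]_z (r z)%:E + tail_value p j = \int[m]_z (r z + ct z)%:E)%E.
  by rewrite opt'E -integralD_EFin.
split.
  rewrite tailE optE (le_trans (leeD2l _ tail_le))// sumE.
  apply: le_integral => //.
  - exact: integrableD ir ict.
  - have [ndW _ [K WK]] := admissible_value_value j.+1.
    apply: (bounded_int _ K).
      by apply: measurable_active_fun; exact: nonincreasing_in_measurable.
    move=> z; case: ifPn => [/andP[_ /andP[z0 zT]]|_].
      have /andP[w0 wK] := WK z.2 (introT andP (conj z0 (ltW zT))).
      by rewrite ger0_norm.
    rewrite normr0.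
    by have /andP[/le_trans/[apply]] : 0 <= value j.+1 0 <= K by apply: WK; rewrite lexx ltW.
  - by move=> z _; rewrite lee_fin; exact: stage_le_best_value.
move=> thr; rewrite tailE optE (tail_eq thr) sumE.
apply: eq_integral => z _; congr EFin; apply: stage_eq_best_value => // az.
by rewrite thr// Mk.
Qed.

Lemma strategy_threshold (theta : nat -> R) :
  strategy M T b (fun k (z : state R) => threshold_policy b (if z.1 then theta k else 0)).
Proof.
move=> k _; split; first by move=> z _; exact: threshold_rate_function (ltW b0).
apply: measurable_funTS; apply: measurable_fun_ifT => //.
apply: measurable_fun_ler => //; apply: measurable_fun_ifT => //.
exact: (measurableT_comp measurable_fst measurable_fst).
Qed.

Lemma threshold_optimal :
  exists p : policy R, T_strategy M T b p /\
    (\sum_(1 <= k < M.+1) \int[state_law T eta p k.-1]_z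
      (stage_utility T nu (c k) (eta k) (p k z) z)%:E =
    ereal_sup [set \sum_(1 <= k < M.+1) \int[state_law T eta q k.-1]_z
      (stage_utility T nu (c k) (eta k) (q k z) z)%:E | q in strategy M T b])%E.
Proof.
pose theta k := switch_time k (value (M - k)).
pose p : policy R := fun k z => threshold_policy b (if z.1 then theta k else 0).
have hp : strategy M T b p by exact: strategy_threshold.
exists p; split.
  split => //; exists (fun k _ => theta k) => k s _ _.
  by split => //; exact: switch_time_itv.
have thr k (z : state R) : (1 <= k <= M)%N -> active T z ->
    p k z = threshold_policy b (theta k).
  by move=> _ /andP[z1 _]; rewrite /p z1.
have [_ /(_ thr) pE] := tail_utility_value hp (leqnn M).
apply/eqP; rewrite eq_le; apply/andP; split.
  by apply: ereal_sup_ubound; exists p.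
apply: ge_ereal_sup => _ [q hq <-].
have [qle _] := tail_utility_value hq (leqnn M).
(* For [j = M] the tail value is taken under the initial Dirac law, so it is the same number for [p]
   and for [q]. *)
by move: pE qle; rewrite /tail_utility /tail_value subnn => ->.
Qed.

End dynamic_programming.

(** * The opponents' failure probability, and the best response *)

Lemma failure_prob01 (R : realType) (T : R) (n : nat) (i : 'I_n)
    (beta : 'I_n -> R) (sigma : 'I_n -> policy R) (k : nat) (s : R) :
  (forall m, m != i -> rate_function T (beta m) 0 (sigma m 1%N (true, 0))) ->
  0 <= s <= T -> 0 <= failure_prob i sigma k s <= 1.
Proof.
move=> hs sT; rewrite /failure_prob; case: ifP => _; last by rewrite ler01 lexx.
rewrite expR_ge0 -[leRHS]expR0 ler_expR oppr_le0 sumr_ge0// => m mi.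
by apply: (abar_ge0 (hs m mi)); case/andP: sT.
Qed.

Lemma abar_nondecreasing (R : realType) (T b tau x y : R) (a : R -> R) :
  rate_function T b tau a -> tau <= x -> x <= y -> y <= T ->
  abar a tau x <= abar a tau y.
Proof.
move=> ha tx xy yT; rewrite -subr_ge0 /abar Rintegral_itvB//.
  apply: Rintegral_ge0 => t /=; rewrite in_itv/= => /andP[xt ty].
  by apply: (rate_ge0 ha); rewrite (le_trans tx (ltW xt)) (le_trans ty).
apply: integrableS (rate_integrable ha) => //.
by apply: subset_itvl; rewrite bnd_simp.
Qed.

Lemma failure_prob_nonincreasing (R : realType) (T : R) (n : nat) (i : 'I_n)
    (beta : 'I_n -> R) (sigma : 'I_n -> policy R) (k : nat) :
  (forall m, m != i -> rate_function T (beta m) 0 (sigma m 1%N (true, 0))) ->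
  {in `[0, T] &, {homo failure_prob i sigma k : x y /~ x <= y}}.
Proof.
move=> hs x y; rewrite !in_itv/= => /andP[x0 xT] /andP[y0 yT] yx.
rewrite /failure_prob; case: (k == 1%N); last by rewrite lexx.
rewrite ler_expR lerN2.
by apply: ler_sum => m mi; exact: abar_nondecreasing (hs m mi) _ _ _.
Qed.

Theorem theorem1 (R : realType) (n M : nat) (T nu : R) (beta : 'I_n -> R)
    (c : 'I_n -> nat -> R)
    (hM : (1 <= M)%N) (hT : 0 < T) (hnu : 0 < nu)
    (hbeta : forall j : 'I_n, 0 < beta j)
    (i : 'I_n) (sigma : 'I_n -> policy R)
    (hsigma : forall m : 'I_n, m != i -> strategy M T (beta m) (sigma m)) :
  exists p : policy R,
    T_strategy M T (beta i) p /\
    utility M T nu (c i) i p sigma =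
      ereal_sup [set utility M T nu (c i) i q sigma
                | q in strategy M T (beta i)].
Proof.
have hs m : m != i -> rate_function T (beta m) 0 (sigma m 1%N (true, 0)).
  (* [hM] guarantees that epoch 1, from which the failure probability is computed, belongs to the
     opponents' strategies. *)
  move=> mi; have [hz _] := hsigma m mi 1%N hM.
  by apply: (hz (true, 0)); rewrite /= lexx ltW.
apply: threshold_optimal => //.
- by move=> k; exact: failure_prob_nonincreasing hs.
- by move=> k s; exact: failure_prob01 hs.
Qed.
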